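(* Let $(\Gamma,h)$ be a 3-valent immersive tropical curve and let $\varphi_0\colon C_0\to X_0$ be a pre-log curve of type $(\Gamma,h)$ in the central fiber of a toric degeneration defined respecting $(\Gamma,h)$. Let $L$ be the loop part of $\Gamma$; cutting $L$ at each 3-valent vertex of $L$ gives a set of piecewise linear segments $\{l_m\}$. Let $U_m\subset N_{\mathbb C}$ be the linear subspace spanned by the direction vectors of the segments of $l_m$. Then elements of the dual obstruction space $H=H^1(C_0,\varphi_0^*\Theta_{\mathfrak X/\mathbb C}/\Theta_{C_0/O_0})^\vee$ are described by the following data (that is, attaching to an element its residues at the flags of $\Gamma$ gives an isomorphism of $H$ with the space of such data): (I) Give the zero vector of $(N_{\mathbb C})^\vee$ to all the flags not contained in $L$. (II) Give a value in $(U_m)^\perp\subset(N_{\mathbb C})^\vee$ to each of the flags associated to the edges of $l_m$. (III) The data in (I) and (II) give an element of $H$ if and only if the following conditions are satisfied. (a) At each vertex $v$ of $\Gamma$, $u_1+u_2+u_3=0$ holds in $(N_{\mathbb C})^\vee$, where $u_1,u_2,u_3$ are the data attached to the three flags of $\Gamma$ which have $v$ as the vertex. (b) The data in (II) are compatible on each edge of $l_m$: the sum of the values attached to the two flags of any edge of $l_m$ is zero.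
   Context: **Tropical curves.** $N$ is a free abelian group of rank $n$, $N_K=N\otimes_{\mathbb Z}K$, $N_{\mathbb C}^\vee$ the dual of $N_{\mathbb C}$, $U^\perp\subset N_{\mathbb C}^\vee$ the annihilator of $U\subset N_{\mathbb C}$. $\Gamma$ is the complement of the set of 1-valent vertices in a connected finite graph with positive integer edge weights $w(E)$; its non-compact edges are unbounded. An immersive tropical curve is a proper continuous map $h\colon\Gamma\to N_{\mathbb R}$ embedding every edge in an affine line of rational slope, mapping vertices into $N_{\mathbb Q}$, and satisfying at every vertex the balancing condition $\sum_jw(E_j)u_j=0$, the sum over edges $E_j$ at the vertex, $u_j\in N$ being the primitive integral direction of $h(E_j)$ pointing away from it. Different edges may have the same image. It is 3-valent if $\Gamma$ is; 2-valent vertices (which may have to be added to define the degeneration) are neglected, so that all vertices of $\Gamma$ are regarded as 3-valent. A flag is a pair $(v,E)$ of a vertex and an adjacent edge. An edge is part of a loop if removing its interior lowers the first Betti number; the loop part $L$ is the union of all such edges. **Degenerations.** Let $X$ be a toric variety whose fan contains all rays spanned by directions of unbounded edges. Choose a rational polyhedral decomposition $\mathscr P$ of $N_{\mathbb R}$ with $h(\Gamma)$ in its 1-skeleton and asymptotic fan defining $X$. After rescaling so that everything is integral and the integral length of each bounded edge is a multiple of its weight, and adding 2-valent vertices so that the vertices of $\mathscr P$ on $h(\Gamma)$ are exactly the images of vertices, the (closures of the) cones over cells of $\mathscr P\times\{1\}$ form a fan in $(N\oplus\mathbb Z)\otimes\mathbb R$ defining a toric degeneration $\mathfrak X\to\mathbb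 C$ of $X$ ''defined respecting $(\Gamma,h)$'', with central fiber $X_0=\bigcup_vX_{0,v}$, $v$ over vertices of $\mathscr P$, $X_{0,v}$ the toric variety of the fan of $\mathscr P$ at $v$. **Pre-log curves.** A curve in a toric variety is torically transverse if it is disjoint from toric strata of codimension greater than one; a stable map to a toric variety is torically transverse if its image is and the preimage of the big torus is dense. A pre-log curve is a stable map $\varphi_0\colon C_0\to X_0$ such that each $C_0\times_{X_0}X_{0,v}\to X_{0,v}$ is torically transverse and every point mapped to the singular locus of $X_0$ is a node whose branches map to different components of $X_0$ with equal intersection multiplicities with the corresponding toric divisors. It is of type $(\Gamma,h)$ (immersive case) if its components $C_{0,v}$ correspond bijectively to the vertices $v$ of $\Gamma$, each $C_{0,v}\cong\mathbb P^1$ is mapped to $X_{0,h(v)}$ by a non-constant torically transverse map meeting the toric divisors exactly in one point for each edge $E$ at $v$ (distinct points for distinct edges), on the divisor corresponding to the direction of $E$, with multiplicity $w(E)$; nodes of $C_0$ correspond to bounded edges of $\Gamma$. **Sheaves.** $\mathfrak X$ carries its toric log structure and $C_0$ the compatible log structure making it log smooth over the standard log point $O_0$. Concretely $\varphi_0^*\Theta_{\mathfrak X/\mathbb C}\cong N\otimes_{\mathbb Z}\mathcal O_{C_0}$; $\Theta_{C_0/O_0}$ is the dual of $\omega_{C_0}(\sum x_k)$, where $x_k$ are the points corresponding to unbounded edges and $\omega_{C_0}$ is the dualizing sheaf (1-forms with at most logarithmic poles at nodes and opposite residues on the two branches); and the inclusion $\Theta_{C_0/O_0}\to N\otimes\mathcal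 O_{C_0}$ is dual to $m\mapsto d\log\varphi_0^*\chi^m$, $m\in N^\vee$ (on each component). By Serre duality $H\cong H^0(C_0,(\varphi_0^*\Theta_{\mathfrak X/\mathbb C}/\Theta_{C_0/O_0})^\vee\otimes\omega_{C_0})\subset H^0(C_0,N_{\mathbb C}^\vee\otimes\omega_{C_0})$; the value of an element at a flag $(v,E)$ is its $N_{\mathbb C}^\vee$-valued residue on $C_{0,v}$ at the point corresponding to $E$ (zero for unbounded $E$). *)

(* Defs.v *)
(* The field of complex numbers is R[i] for R : realType. *)
From HB Require Import structures.
From mathcomp Require Import all_boot all_order all_algebra.
From mathcomp Require Import complex.
From mathcomp Require Import boolp classical_sets functions cardinality reals.

Set Implicit Arguments.
Unset Strict Implicit.
Unset Printing Implicit Defensive.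

Import Order.TTheory GRing.Theory Num.Theory.
Local Open Scope ring_scope.

(* N and its dual N^\vee are both 'rV[int]_n, paired by [dot]. *)

Definition dot (S : pzRingType) n (m x : 'rV[S]_n) : S :=
  \sum_(i < n) m 0 i * x 0 i.

Definition ext (S : pzRingType) n (u : 'rV[int]_n) : 'rV[S]_n :=
  map_mx intr u.
Arguments ext S {n} u.

Definition extQ (R : realType) n (x : 'rV[rat]_n) : 'rV[R]_n := map_mx ratr x.
Arguments extQ R {n} x.

Definition primitive n (u : 'rV[int]_n) : Prop :=
  forall (k : nat) (u' : 'rV[int]_n), u = u' *+ k -> k = 1%N.

Local Open Scope set_scope.

(* [ends e false] and [ends e true] are the two ends of [e]; [None] stands for
   a removed 1-valent vertex. *)
Record graph := Graph {
  vert : finType;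
  edge : finType;
  ends : edge -> bool -> option vert }.
Arguments ends : clear implicits.

Section Graphs.
Variable G : graph.

Definition bounded (e : edge G) : bool := ends G e false && ends G e true.

Definition at_vertex (v : vert G) : {set edge G * bool} :=
  [set f | ends G f.1 f.2 == Some v].

(* Pairs (v, E): an edge together with one of its ends that is a vertex. *)
Definition flag := {f : edge G * bool | ends G f.1 f.2}.

Definition flag_edge (f : flag) : edge G := (val f).1.

Definition trivalent : Prop := forall v : vert G, #|at_vertex v| = 3%N.

Definition incident : rel (vert G + edge G) := fun x y =>
  match x, y with
  | inl v, inr e | inr e, inl v =>
      (ends G e false == Some v) || (ends G e true == Some v)
  | _, _ => false
  end.

Definition connected_graph : Prop :=
  forall x y : vert G + edge G, connect incident x y.

(* The simplicial boundary map C_1 -> C_0 of the compact edges in [A]. *)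
Definition boundary (A : {set edge G}) :
    'M[rat]_(#|[set e in A | bounded e]|, #|vert G|) :=
  \matrix_(i, j)
    ((ends G (enum_val i) true == Some (enum_val j))%:R
     - (ends G (enum_val i) false == Some (enum_val j))%:R).

(* First Betti number of the union of all vertices and of the edges in [A];
   non-compact edges do not contribute to the homology. *)
Definition betti1 (A : {set edge G}) : nat := \rank (kermx (boundary A)).

Definition loop_part : {set edge G} :=
  [set e | (betti1 ([set: edge G] :\ e) < betti1 [set: edge G])%N].

Definition loop_valence (v : vert G) : nat :=
  #|[set f in at_vertex v | f.1 \in loop_part]|.

(* Adjacent edges of L that are not separated by the cuts at the 3-valent
   vertices of L. *)
Definition uncut_adjacent : rel (edge G) := fun e e' =>
  [&& e \in loop_part, e' \in loop_part &
    [exists v, [&& loop_valence v != 3%N,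
      [exists b, ends G e b == Some v] & [exists b, ends G e' b == Some v]]]].

Definition segments : {set {set edge G}} :=
  [set [set e' | connect uncut_adjacent e e'] | e in loop_part].

End Graphs.

Local Close Scope set_scope.

Local Open Scope classical_set_scope.

(* [dir e] is the primitive direction of h(e) from the end [false] to the end
   [true], and [base e] is any point of the affine line containing h(e) (it is
   determined up to translation along [dir e] as soon as [e] has a vertex). *)
Record tropical_data (R : realType) (n : nat) := TropicalData {
  tgraph :> graph;
  weight : edge tgraph -> nat;
  pos : vert tgraph -> 'rV[rat]_n;
  base : edge tgraph -> 'rV[R]_n;
  dir : edge tgraph -> 'rV[int]_n }.

Section Tropical.
Variables (R : realType) (n : nat).
Implicit Type T : tropical_data R n.

Definition sgb (S : pzRingType) (b : bool) : S := (-1) ^+ b.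
Arguments sgb S b : clear implicits.

(* Primitive direction of [e] pointing away from its end [b]. *)
Definition out_dir T (e : edge T) (b : bool) : 'rV[int]_n := sgb int b *: dir e.

Definition posR T (v : vert T) : 'rV[R]_n := extQ R (pos v).

Definition edge_line T (e : edge T) : set 'rV[R]_n :=
  [set x | exists t : R, x = base e + t *: ext R (dir e)].

(* The closed image h(e). *)
Definition edge_image T (e : edge T) : set 'rV[R]_n :=
  [set x | edge_line e x /\
     forall b v, ends T e b = Some v ->
       exists2 s : R, 0 <= s & x = posR v + s *: ext R (out_dir e b)].

Definition curve_image T : set 'rV[R]_n :=
  [set x | exists e : edge T, edge_image e x].

Record immersive_tropical_curve T : Prop := ImmersiveTropicalCurve {
  tc_connected : connected_graph T;
  tc_weight : forall e : edge T, (0 < weight e)%N;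
  tc_primitive : forall e : edge T, primitive (dir e);
  tc_line : forall (e : edge T) b v,
    ends T e b = Some v -> edge_line e (posR v);
  tc_bounded : forall (e : edge T) v w,
    ends T e false = Some v -> ends T e true = Some w ->
    exists2 s : R, 0 < s & posR w = posR v + s *: ext R (dir e);
  tc_balanced : forall v : vert T,
    \sum_(f in at_vertex v) (out_dir f.1 f.2 *+ weight f.1) = 0 }.

(* [nsub e] vertices are added on [e], numbered from the end [false] to the
   end [true]. *)
Record subdivision T := Subdivision {
  nsub : edge T -> nat;
  sub_pos : forall e : edge T, 'I_(nsub e) -> 'rV[rat]_n }.

Section Subdivide.
Variables (T : tropical_data R n) (S : subdivision T).

Definition sub_vert : finType := (vert T + {e : edge T & 'I_(nsub S e)})%type.
Definition sub_edge : finType := {e : edge T & 'I_(nsub S e).+1}.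

(* The i-th piece of [e] joins the (i-1)-st and the i-th added vertices. *)
Definition sub_ends (e : sub_edge) (b : bool) : option sub_vert :=
  let new (j : 'I_(nsub S (tag e))) : sub_vert :=
    inr (Tagged (fun e => 'I_(nsub S e)) j) in
  if unlift (if b then ord_max else ord0) (tagged e) is Some j
  then Some (new j) else omap inl (ends T (tag e) b).

Definition subdivide : tropical_data R n :=
  @TropicalData R n (@Graph sub_vert sub_edge sub_ends)
    (fun e => weight (tag e))
    (fun v => match v with
              | inl v => pos v
              | inr x => sub_pos (tagged x)
              end)
    (fun e => base (tag e))
    (fun e => dir (tag e)).

(* The piece of [e] adjacent to its end [b]. *)
Definition end_piece (e : edge T) (b : bool) : edge subdivide :=
  Tagged (fun e => 'I_(nsub S e).+1)
    ((if b then ord_max else ord0) : 'I_(nsub S e).+1).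

End Subdivide.
End Tropical.
Arguments sgb S b : clear implicits.

Section Polyhedra.
Variables (R : realType) (n : nat).
Implicit Types (P Q F C : set 'rV[R]_n) (K : set (set 'rV[R]_n)).

Definition rational_polyhedron P : Prop :=
  exists s : seq ('rV[int]_n * rat),
    P = [set x | forall h, h \in s -> ratr h.2 <= dot (ext R h.1) x].

Definition line_free P : Prop :=
  forall x d, (forall t : R, P (x + t *: d)) -> d = 0.

(* Nonempty faces; [m = 0] gives the polyhedron itself. *)
Definition face_of F P : Prop :=
  F !=set0 /\
  exists (m : 'rV[int]_n) (c : R),
    (forall x, P x -> c <= dot (ext R m) x) /\
    F = P `&` [set x | dot (ext R m) x = c].

Record polyhedral_complex K : Prop := PolyhedralComplex {
  pc_finite : finite_set K;
  pc_rational : forall P, K P -> rational_polyhedron P;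
  pc_nonempty : forall P, K P -> P !=set0;
  pc_line_free : forall P, K P -> line_free P;
  pc_face : forall P F, K P -> face_of F P -> K F;
  pc_inter : forall P Q, K P -> K Q -> P `&` Q !=set0 -> face_of (P `&` Q) P }.

Definition polyhedral_decomposition K : Prop :=
  polyhedral_complex K /\ forall x, exists2 P, K P & P x.

Definition is_fan K : Prop :=
  polyhedral_complex K /\
  forall C, K C -> forall x (t : R), 0 <= t -> C x -> C (t *: x).

Definition dim_le1 P : Prop :=
  exists x d, forall y, P y -> exists t : R, y = x + t *: d.

Definition skeleton1 K : set 'rV[R]_n :=
  [set x | exists P, [/\ K P, dim_le1 P & P x]].

Definition ray (u : 'rV[int]_n) : set 'rV[R]_n :=
  [set x | exists2 t : R, 0 <= t & x = t *: ext R u].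

Definition recession_cone P : set 'rV[R]_n :=
  [set d | forall x (t : R), P x -> 0 <= t -> P (x + t *: d)].

Definition asymptotic_fan K : set (set 'rV[R]_n) := recession_cone @` K.

Definition tangent_cone P (x : 'rV[R]_n) : set 'rV[R]_n :=
  [set d | exists2 t : R, 0 < t & P (x + t *: d)].

(* The fan of X_{0,x} for a vertex x of the decomposition K. *)
Definition fan_at K (x : 'rV[R]_n) : set (set 'rV[R]_n) :=
  [set C | exists P, [/\ K P, P x & C = tangent_cone P x]].

Definition dual_cone C : set 'rV[int]_n :=
  [set m | forall d, C d -> 0 <= dot (ext R m) d].

Definition annihilator C : set 'rV[int]_n :=
  [set m | forall d, C d -> dot (ext R m) d = 0].

End Polyhedra.
Arguments ray R {n} u.

(* The toric variety X is given by its fan [Sigma], the degeneration by the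
    polyhedral decomposition [K] of N_R, the scaling factor [d] and the added
    2-valent vertices [S].  Rescaling by [d] does not change the fans of the
    components of the central fiber. *)
Record respects (R : realType) (n : nat) (T : tropical_data R n)
    (S : subdivision T) (Sigma K : set (set 'rV[R]_n)) (d : nat) : Prop :=
    Respects {
  deg_fan : is_fan Sigma;
  deg_rays : forall (e : edge T) b,
    ends T e b = None -> Sigma (ray R (- out_dir e b));
  deg_decomposition : polyhedral_decomposition K;
  deg_asymptotic : asymptotic_fan K = Sigma;
  deg_skeleton : curve_image T `<=` skeleton1 K;
  deg_subdivision : immersive_tropical_curve (subdivide S);
  deg_vertices : forall x : 'rV[R]_n,
    (K [set x] /\ curve_image T x) <->
    (exists v : vert (subdivide S), x = posR v);
  deg_scale : (0 < d)%N;
  deg_integral : forall x : 'rV[R]_n,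
    K [set x] -> exists z : 'rV[int]_n, d%:R *: x = ext R z;
  deg_length : forall (e : edge (subdivide S)) v w,
    ends (subdivide S) e false = Some v -> ends (subdivide S) e true = Some w ->
    exists k : nat,
      d%:R *: (posR w - posR v) = (k * weight e)%:R *: ext R (dir e) }.

Notation ratfun R := {fraction {poly R[i]}}.

Section ProjectiveLine.
Variable R : realType.

(* [Some a] is the point a of the affine line, [None] is infinity. *)
Definition P1 : Type := option R[i].

Definition ratC (c : R[i]) : ratfun R := tofrac c%:P.
Definition ratX : ratfun R := tofrac 'X.

Definition rnum (x : ratfun R) : {poly R[i]} := \n_(repr x).
Definition rden (x : ratfun R) : {poly R[i]} := \d_(repr x).

(* Order of vanishing of a nonzero rational function. *)
Definition ord (p : P1) (x : ratfun R) : int :=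
  match p with
  | Some a => (mup a (rnum x))%:Z - (mup a (rden x))%:Z
  | None => (size (rden x))%:Z - (size (rnum x))%:Z
  end.

Definition regular (p : P1) (x : ratfun R) : Prop := x = 0 \/ 0 <= ord p x.

Definition has_value (p : P1) (x : ratfun R) (c : R[i]) : Prop :=
  x = ratC c \/ 0 < ord p (x - ratC c).

Definition dlog (x : ratfun R) : ratfun R :=
  tofrac (rnum x)^`() / tofrac (rnum x) - tofrac (rden x)^`() / tofrac (rden x).

(* A rational function g also stands for the rational 1-form g dt, t = ratX;
   dt has a double pole at infinity. *)
Definition form_ord (p : P1) (g : ratfun R) : int :=
  ord p g - (if p is None then 2 else 0).

Definition form_regular (p : P1) (g : ratfun R) : Prop :=
  g = 0 \/ 0 <= form_ord p g.

Definition form_log_pole (p : P1) (g : ratfun R) : Prop :=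
  g = 0 \/ -1 <= form_ord p g.

(* The residue of a form with at most a simple pole is the value of
   (t - a) g, respectively of - t g at infinity. *)
Definition residue (p : P1) (g : ratfun R) : R[i] :=
  xget 0 [set c | match p with
                  | Some a => has_value p ((ratX - ratC a) * g) c
                  | None => has_value p (- (ratX * g)) c
                  end].

End ProjectiveLine.
Arguments ratC {R} c.
Arguments ratX {R}.

Section ToricMaps.
Variables (R : realType) (n : nat).
Implicit Types (f : 'rV[int]_n -> ratfun R) (C : set 'rV[R]_n).

(* A map from P^1 to a toric variety sending the generic point to the big
   torus is given by the pullbacks [f m] of the characters chi^m. *)
Definition is_character_map f : Prop :=
  (forall m, f m != 0) /\ (forall m m', f (m + m') = f m * f m').

(* The map is regular at [p], with values in the affine chart
   Spec C[C^\vee \cap N^\vee] near [p], and sends [p] to its closed orbit. *)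
Definition in_orbit f (p : P1 R) C : Prop :=
  forall m, dual_cone C m ->
    regular p (f m) /\ (ord p (f m) = 0 <-> annihilator C m).

(* A toric variety is the union of its affine charts, hence of its orbits. *)
Definition is_toric_map (Sigma : set (set 'rV[R]_n)) f : Prop :=
  is_character_map f /\ forall p, exists2 C, Sigma C & in_orbit f p C.

Definition torically_transverse (Sigma : set (set 'rV[R]_n)) f : Prop :=
  is_toric_map Sigma f /\
  forall p C, Sigma C -> in_orbit f p C -> dim_le1 C.

Definition meets_boundary (Sigma : set (set 'rV[R]_n)) f (p : P1 R) : Prop :=
  exists C, [/\ Sigma C, in_orbit f p C & C <> [set 0]].

(* Intersection multiplicity [k] at [p] with the toric divisor of the ray
   through the primitive vector [u]; in the chart of that ray the divisor is
   cut out by chi^m for any m with <m,u> = 1. *)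
Definition meets_divisor (Sigma : set (set 'rV[R]_n)) f (p : P1 R)
    (u : 'rV[int]_n) (k : nat) : Prop :=
  [/\ Sigma (ray R u), in_orbit f p (ray R u)
    & forall m, dot m u = 1 -> ord p (f m) = k%:Z].

End ToricMaps.

Section PreLog.
Variables (R : realType) (n : nat).
(* [T] is the tropical curve after adding the 2-valent vertices. *)
Variables (T : tropical_data R n) (K : set (set 'rV[R]_n)).

(* C_0 is glued from a copy of P^1 for each vertex [v]; [fpt e b] is the point
   corresponding to the flag ([v], [e]), where [v] is the end [b] of [e].  For
   bounded [e] the points [fpt e false] and [fpt e true] are identified to a
   node; for unbounded [e] one obtains the marked points x_k. *)
Record curve_map := CurveMap {
  cmap : vert T -> 'rV[int]_n -> ratfun R;
  fpt : edge T -> bool -> P1 R }.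

Variable phi : curve_map.

(* The set of points of X_0 is the disjoint union over the cells P in K of the
   tori Hom (P^\perp \cap N^\vee, C \ 0).  This says that the images of [p] in
   C_{0,v} and of [q] in C_{0,w} are the same point of X_0. *)
Definition same_image (v w : vert T) (p q : P1 R) : Prop :=
  exists P, [/\ K P, P (posR v), P (posR w),
    in_orbit (cmap phi v) p (tangent_cone P (posR v)) /\
    in_orbit (cmap phi w) q (tangent_cone P (posR w))
  & forall m, annihilator (tangent_cone P (posR v)) m ->
      exists2 c, has_value p (cmap phi v m) c & has_value q (cmap phi w m) c].

(* The singular locus of X_0 is the union of the intersections of its
   components, i.e. of the strata of cells with at least two vertices. *)
Definition maps_to_singular (v : vert T) (p : P1 R) : Prop :=
  exists P y, [/\ K P, P (posR v),
    in_orbit (cmap phi v) p (tangent_cone P (posR v)),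
    K [set y] /\ P y & y <> posR v].

Record prelog_of_type : Prop := PrelogOfType {
  pl_transverse : forall v,
    torically_transverse (fan_at K (posR v)) (cmap phi v);
  pl_nonconstant : forall v, exists m, forall c, cmap phi v m <> ratC c;
  pl_distinct : forall v e b e' b',
    ends T e b = Some v -> ends T e' b' = Some v ->
    fpt phi e b = fpt phi e' b' -> (e, b) = (e', b');
  pl_flag : forall v e b, ends T e b = Some v ->
    meets_divisor (fan_at K (posR v)) (cmap phi v) (fpt phi e b)
      (out_dir e b) (weight e);
  pl_exact : forall v p, meets_boundary (fan_at K (posR v)) (cmap phi v) p ->
    exists e b, ends T e b = Some v /\ p = fpt phi e b;
  (* Equality of the intersection multiplicities of the two branches, both
     equal to [weight e], is part of [pl_flag]. *)
  pl_node : forall e v w, ends T e false = Some v -> ends T e true = Some w ->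
    posR v <> posR w /\ same_image v w (fpt phi e false) (fpt phi e true);
  pl_singular : forall v p, maps_to_singular v p ->
    exists e b, [/\ bounded e, ends T e b = Some v & p = fpt phi e b] }.

(* A section of N_C^\vee (x) omega_{C_0} is a family of vectors of rational
   1-forms on the components. *)
Definition omega_section (xi : {ffun vert T -> 'rV[ratfun R]_n}) : Prop :=
  (forall v p i,
     (forall e b, bounded e -> ends T e b = Some v -> p <> fpt phi e b) ->
     form_regular p (xi v 0 i)) /\
  (forall v e b i, bounded e -> ends T e b = Some v ->
     form_log_pole (fpt phi e b) (xi v 0 i)) /\
  (forall e v w i, ends T e false = Some v -> ends T e true = Some w ->
     residue (fpt phi e false) (xi v 0 i)
     + residue (fpt phi e true) (xi w 0 i) = 0).

(* The image in N (x) O of the vector field theta d/dt on C_{0,v}: the i-th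
   coordinate is the contraction with d log phi^* chi^{e_i^*}. *)
Definition log_tangent (v : vert T) (theta : ratfun R) : 'rV[ratfun R]_n :=
  \row_i (theta * dlog (cmap phi v (delta_mx 0 i))).

(* The space H, realized by Serre duality as the global sections of
   (phi^* Theta / Theta_{C_0})^\vee (x) omega, i.e. the sections of
   N_C^\vee (x) omega that vanish on Theta_{C_0}.  As omega is torsion free,
   the vanishing may be tested at the generic points of the components. *)
Definition dual_obstruction : set {ffun vert T -> 'rV[ratfun R]_n} :=
  [set xi | omega_section xi /\
     forall v theta, dot (xi v) (log_tangent v theta) = 0].

Definition residue_at (xi : {ffun vert T -> 'rV[ratfun R]_n})
    (e : edge T) (b : bool) : 'rV[R[i]]_n :=
  if ends T e b is Some v
  then \row_i residue (fpt phi e b) (xi v 0 i) else 0.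

End PreLog.

(* The values of [xi] at the flags of the original curve [T]. *)
Definition flag_residues (R : realType) (n : nat) (T : tropical_data R n)
    (S : subdivision T) (phi : curve_map (subdivide S))
    (xi : {ffun vert (subdivide S) -> 'rV[ratfun R]_n}) :
    {ffun flag T -> 'rV[R[i]]_n} :=
  [ffun f => residue_at phi xi (end_piece S (flag_edge f) (val f).2) (val f).2].

Section Data.
Variables (R : realType) (n : nat) (T : tropical_data R n).
Implicit Type D : {ffun flag T -> 'rV[R[i]]_n}.

(* The subspace U_m of N_C. *)
Definition segment_span (l : {set edge T}) : {vspace 'rV[R[i]]_n} :=
  (\sum_(e in l) <[ext R[i] (dir e)]>)%VS.

Definition data_I D : Prop :=
  forall f : flag T, flag_edge f \notin loop_part T -> D f = 0.

Definition data_II D : Prop :=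
  forall l, l \in segments T -> forall f : flag T, flag_edge f \in l ->
    forall u, u \in segment_span l -> dot (D f) u = 0.

Definition data_a D : Prop :=
  forall v : vert T, \sum_(f : flag T | val f \in at_vertex v) D f = 0.

Definition data_b D : Prop :=
  forall l, l \in segments T -> forall f f' : flag T,
    flag_edge f \in l -> flag_edge f' = flag_edge f -> f != f' ->
    D f + D f' = 0.

Definition loop_data : set {ffun flag T -> 'rV[R[i]]_n} :=
  [set D | [/\ data_I D, data_II D, data_a D & data_b D]].

End Data.

(* Main.v *)
Require Import Defs.
From HB Require Import structures.
From mathcomp Require Import all_boot all_order all_algebra.
From mathcomp Require Import complex.
From mathcomp Require Import boolp classical_sets functions cardinality reals.
From mathcomp Require Import ring zify.

Set Implicit Arguments.
Unset Strict Implicit.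
Unset Printing Implicit Defensive.

Import Order.TTheory GRing.Theory Num.Theory.
Local Open Scope ring_scope.

(** The components of the curve are projective lines, so that everything about
    them can be computed with rational functions.  Write dt for the standard
    form, and let q_f be the point of the component of a vertex that corresponds
    to the flag f at this vertex.

    A section of the sheaf of N^\vee-valued 1-forms has at most simple poles,
    located at the points q_f, so on each component it is the sum of its polar
    parts, its residues r_f add up to zero at each vertex, and it is determined
    by them ([partial_fractions], [section_fractions]).  The residue vanishes on
    unbounded edges, and the two residues along a bounded edge are opposite.
    The same applies to d log of the characters: the residue of d log chi^m is
    the order of vanishing of chi^m ([dlog_value]), which by transversality is
    zero away from the q_f and w(E) <m, u> at the flag of E, u being the
    primitive direction ([ord_meets_divisor], [ord_off_boundary]).

    A section lies in the dual obstruction space when its contraction with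
    d log is zero.  This contraction is a quadratic differential with at most
    double poles at the q_f, whose leading coefficient at q_f is w(E) <r_f, u>;
    hence r_f annihilates the direction of its edge.  Conversely, at a vertex of
    valence at most 3 the vanishing of all leading coefficients is enough: the
    balancing conditions for r and for w(E) u make the matrix of all pairings
    between flags antisymmetric ([dot_antisymmetric]), whereas the contraction
    only sees its symmetric part.  So the dual obstruction space is the space of
    residue flows: families r that add up to zero at each vertex and along each
    edge, and with r_f orthogonal to the direction of the edge
    ([residue_at_flow], [residue_at_inj], [flow_section_obstruction]).

    Residue flows do not change along a subdivided edge ([flow_pieces]), so that
    they can be read off from the original trivalent curve
    ([subdivide_flow]).  There a residue flow is a cycle with coefficients in
    N_C^\vee.  It vanishes off the loop part, because every cycle does
    ([cycle_off_loop_part]).  At a vertex where two edges of the loop part meet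
    without being cut the third edge is off the loop part, so that the values on
    the two edges agree up to sign ([uncut_adjacent_orth]).  Along a segment the
    value is therefore constant up to sign, and being orthogonal to the edge that
    carries it, it is orthogonal to all directions of the segment.  This gives
    conditions (I) and (II), and (a) and (b) are the definition of a cycle. *)

(** * Valuations of rational functions on the projective line *)

Section RationalFunctions.
Variable R : realType.
Local Notation C := R[i].
Local Notation "P %:F" := (tofrac P).
Implicit Types (p : P1 R) (x y g : ratfun R) (P Q : {poly C}) (c : C).

HB.instance Definition _ :=
  GRing.RMorphism.copy (@ratC R) (@FracField.tofrac {poly C} \o polyC).

Lemma rden_neq0 x : rden x != 0.
Proof. exact: denom_ratioP. Qed.

Lemma ratfunE x : x = (rnum x)%:F / (rden x)%:F.
Proof.
have dn0 : (rden x)%:F != 0 by rewrite tofrac_eq0 rden_neq0.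
apply: (mulIf dn0); rewrite mulfVK //; move: dn0 => _.
rewrite /rnum /rden -[x in LHS]reprK; unlock tofrac.
rewrite -[LHS]FracField.pi_mul; apply/eqmodP; rewrite /= FracField.equivfE.
rewrite /FracField.mulf !numden_Ratio ?mulf_neq0 ?oner_neq0 ?denom_ratioP //.
by rewrite reprK !mulr1 mulrC.
Qed.

(** The order of a polynomial at infinity is minus its degree, and [size] is the
    degree plus one. *)
Definition poly_ord p P : int :=
  match p with Some a => (mup a P)%:Z | None => 1 - (size P)%:Z end.

Lemma poly_ordM p P Q :
  P != 0 -> Q != 0 -> poly_ord p (P * Q) = poly_ord p P + poly_ord p Q.
Proof.
move=> P0 Q0; case: p => [a|] /=; first by rewrite mupM // PoszD.
move: P0 Q0 (size_mul P0 Q0); rewrite -!size_poly_gt0.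
by move: (size P) (size Q) (size (P * Q)) => i j k; lia.
Qed.

Lemma poly_ordD p P Q (k : int) : P != 0 -> Q != 0 -> P + Q != 0 ->
  k <= poly_ord p P -> k <= poly_ord p Q -> k <= poly_ord p (P + Q).
Proof.
move=> P0 Q0 PQ0; case: p => [a|] /=.
  by case: k => [k|//]; rewrite !lez_nat !mup_geq //; apply: dvdp_add.
have := size_polyD P Q; rewrite leq_max.
by move: (size P) (size Q) (size (P + Q)) => i j l; lia.
Qed.

Lemma poly_ordC p c : c != 0 -> poly_ord p c%:P = 0.
Proof.
case: p => [a|] c0 /=; last by rewrite size_polyC c0.
by rewrite mupNroot // rootC.
Qed.

(** The order of a fraction is defined through a chosen representative, not
    necessarily in lowest terms; this frees it from the choice. *)
Lemma ord_ratio p P Q :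
  P != 0 -> Q != 0 -> ord p (P%:F / Q%:F) = poly_ord p P - poly_ord p Q.
Proof.
move=> P0 Q0; set x := P%:F / Q%:F; have d0 := rden_neq0 x.
have E : rnum x * Q = P * rden x.
  apply/eqP; rewrite -tofrac_eq !tofracM -[P%:F](@mulfVK _ Q%:F) ?tofrac_eq0 //.
  by rewrite -/x [X in _ == X * _ * _]ratfunE mulrAC mulfVK ?tofrac_eq0.
have n0 : rnum x != 0.
  by apply: contra_neq (mulf_neq0 P0 d0) => n0; rewrite -E n0 mul0r.
have := congr1 (poly_ord p) E; rewrite !poly_ordM // => Eo.
have -> : ord p x = poly_ord p (rnum x) - poly_ord p (rden x).
  by case: (p) => [a|//] /=; lia.
by lia.
Qed.

Lemma ratfunP x : x != 0 ->
  exists P Q, [/\ P != 0, Q != 0 & x = P%:F / Q%:F].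
Proof.
move=> x0; exists (rnum x), (rden x); split; rewrite ?rden_neq0 -?ratfunE //.
by apply: contra_neq x0 => n0; rewrite [x]ratfunE n0 tofrac0 mul0r.
Qed.

Lemma ordM p x y : x != 0 -> y != 0 -> ord p (x * y) = ord p x + ord p y.
Proof.
move=> /ratfunP[P [Q [P0 Q0 ->]]] /ratfunP[P' [Q' [P0' Q0' ->]]].
rewrite mulf_div -!tofracM !ord_ratio ?mulf_neq0 // !poly_ordM //.
by lia.
Qed.

Lemma ord_poly p P : P != 0 -> ord p P%:F = poly_ord p P.
Proof.
move=> P0; rewrite -[P%:F]divr1 -tofrac1 ord_ratio ?oner_eq0 //.
have -> : poly_ord p 1 = 0 by rewrite -polyC1 poly_ordC ?oner_eq0.
by rewrite subr0.
Qed.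

Lemma ratC_eq0 c : (ratC c == 0 :> ratfun R) = (c == 0).
Proof. by rewrite tofrac_eq0 polyC_eq0. Qed.

Lemma ord_ratC p c : c != 0 -> ord p (ratC c) = 0.
Proof. by move=> c0; rewrite ord_poly ?polyC_eq0 // poly_ordC. Qed.

(** The fractional ideal of the functions vanishing to order [k]: regular
    functions are the case [k = 0], functions with value 0 the case [k = 1]. *)
Definition ord_ge p (k : int) x : Prop := x = 0 \/ k <= ord p x.

Lemma ord_ge_le p k l x : l <= k -> ord_ge p k x -> ord_ge p l x.
Proof. by move=> lk [->|kx]; [left|right; apply: le_trans kx]. Qed.

Lemma ord_geD p k x y : ord_ge p k x -> ord_ge p k y -> ord_ge p k (x + y).
Proof.
move=> [->|kx]; first by rewrite add0r.
move=> [->|ky]; first by rewrite addr0; right.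
have [->|x0] := eqVneq x 0; first by rewrite add0r; right.
have [->|y0] := eqVneq y 0; first by rewrite addr0; right.
have [->|xy0] := eqVneq (x + y) 0; [by left | right].
move: kx ky xy0; have [P [Q [P0 Q0 ->]]] := ratfunP x0.
have [P' [Q' [P0' Q0' ->]]] := ratfunP y0.
rewrite addf_div ?tofrac_eq0 // -!tofracM -tofracD mulf_eq0 negb_or tofrac_eq0.
move=> kx ky /andP[s0 _]; move: kx ky.
rewrite !ord_ratio ?mulf_neq0 // => kx ky; rewrite lerBrDr.
by apply: poly_ordD; rewrite ?mulf_neq0 // !poly_ordM //; lia.
Qed.

Lemma ord_geM p k l x y : ord_ge p k x -> ord_ge p l y -> ord_ge p (k + l) (x * y).
Proof.
move=> [->|kx]; first by left; rewrite mul0r.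
move=> [->|ky]; first by left; rewrite mulr0.
have [->|x0] := eqVneq x 0; first by left; rewrite mul0r.
have [->|y0] := eqVneq y 0; first by left; rewrite mulr0.
by right; rewrite (ordM p x0 y0); apply: lerD.
Qed.

Lemma ord_ge_ratC p c : ord_ge p 0 (ratC c).
Proof.
have [->|c0] := eqVneq c 0; first by left; rewrite rmorph0.
by right; rewrite ord_ratC.
Qed.

(** * Values at a point *)

Lemma has_valueE p x c : has_value p x c <-> ord_ge p 1 (x - ratC c).
Proof.
split=> [[->|h]|[/eqP|h]]; first by left; rewrite subrr.
- by right; rewrite -gtz0_ge1.
- by rewrite subr_eq0 => /eqP; left.
- by right; rewrite gtz0_ge1.
Qed.

Lemma has_value_regular p x c : has_value p x c -> regular p x.
Proof.
move=> /has_valueE h; rewrite -[x](subrK (ratC c)).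
by apply: (@ord_geD p 0); [apply: ord_ge_le h | apply: ord_ge_ratC].
Qed.

Lemma has_valueC p c : has_value p (ratC c) c.
Proof. by left. Qed.

Lemma has_valueD p x y c d :
  has_value p x c -> has_value p y d -> has_value p (x + y) (c + d).
Proof.
move=> /has_valueE hx /has_valueE hy; apply/has_valueE.
by rewrite rmorphD opprD addrACA; apply: ord_geD.
Qed.

Lemma has_valueM p x y c d :
  has_value p x c -> has_value p y d -> has_value p (x * y) (c * d).
Proof.
move=> hx hy; have rx := has_value_regular hx.
move: hx hy => /has_valueE hx /has_valueE hy; apply/has_valueE.
have -> : x * y - ratC (c * d) = x * (y - ratC d) + (x - ratC c) * ratC d.
  by rewrite rmorphM /=; ring.
apply: ord_geD; first by rewrite -[1]add0r; apply: ord_geM.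
by rewrite -[1]addr0; apply: ord_geM => //; apply: ord_ge_ratC.
Qed.

Lemma has_valueN p x c : has_value p x c -> has_value p (- x) (- c).
Proof.
rewrite -mulN1r -[- c]mulN1r -(rmorphN1 (@ratC R)).
by apply: has_valueM; apply: has_valueC.
Qed.

Lemma has_value_sum p (I : finType) (A : pred I) (F : I -> ratfun R) (c : I -> C) :
  (forall i, A i -> has_value p (F i) (c i)) ->
  has_value p (\sum_(i | A i) F i) (\sum_(i | A i) c i).
Proof.
move=> h; apply: (big_rec2 (has_value p)) => [|i x y iA]; last first.
  by apply: has_valueD; apply: h.
by left; rewrite rmorph0.
Qed.

Lemma has_value_uniq p x c d : has_value p x c -> has_value p x d -> c = d.
Proof.
move=> hc hd; apply/eqP; rewrite -subr_eq0; apply/negP => /negP cd0.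
have := has_valueD hd (has_valueN hc); rewrite subrr => /has_valueE.
rewrite sub0r -rmorphN opprB => -[/eqP|]; rewrite ?ratC_eq0 ?(negPf cd0) //.
by rewrite ord_ratC.
Qed.

(** Comparing P with c Q avoids cancelling common factors, and treats infinity
    like the other points. *)
Lemma has_value_ratio p P Q c : Q != 0 ->
  P - c *: Q = 0 \/ poly_ord p Q < poly_ord p (P - c *: Q) ->
  has_value p (P%:F / Q%:F) c.
Proof.
move=> Q0 h; apply/has_valueE.
have -> : P%:F / Q%:F - ratC c = (P - c *: Q)%:F / Q%:F.
  by rewrite tofracB mulrBl -mul_polyC tofracM mulfK ?tofrac_eq0.
have [->|D0] := eqVneq (P - c *: Q) 0; first by left; rewrite tofrac0 mul0r.
right; rewrite ord_ratio //; case: h => [/eqP|]; first by rewrite (negPf D0).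
by lia.
Qed.

(** If numerator and denominator vanish to the same order, the value is the ratio
    of their leading terms: the cofactors of the common power of t - a at a, the
    leading coefficients at infinity. *)
Lemma regular_has_value p x : regular p x -> exists c, has_value p x c.
Proof.
move=> [->|]; first by exists 0; left; rewrite rmorph0.
have [->|x0] := eqVneq x 0; first by exists 0; left; rewrite rmorph0.
have [P [Q [P0 Q0 ->]]] := ratfunP x0; rewrite ord_ratio // subr_ge0.
rewrite le_eqVlt => /predU1P[E|lt]; last first.
  by exists 0; apply: has_value_ratio => //; rewrite scale0r subr0; right.
case: p E => [a|] /= E.
  have [k [EP EQ]] : exists k : nat, k = mup a P /\ k = mup a Q.
    by exists (mup a P); split=> //; apply/eqP; rewrite -eqz_nat E.
  set Z := ('X - a%:P) ^+ k.
  have Z0 : Z != 0 by rewrite expf_neq0 // polyXsubC_eq0.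
  have mupZ : mup a Z = k by rewrite mup_XsubCX eqxx.
  have /dvdpP[P1 P1E] : Z %| P by rewrite -mup_geq // EP.
  have /dvdpP[Q1 Q1E] : Z %| Q by rewrite -mup_geq // EQ.
  have Q10 : Q1 != 0 by apply: contra_neq Q0 => Q10; rewrite Q1E Q10 mul0r.
  have mQ1 : mup a Q1 = 0%N by move: EQ; rewrite Q1E mupM // mupZ; lia.
  have Q1a : Q1.[a] != 0.
    by rewrite -/(root Q1 a) -dvdp_XsubCl XsubC_dvd // mQ1.
  exists (P1.[a] / Q1.[a]); apply: has_value_ratio => //.
  set c := _ / _; set D := P - _; have [->|D0] := eqVneq D 0; [by left | right].
  have DE : D = (P1 - c *: Q1) * Z.
    by rewrite /D [X in X - _]P1E [in X in _ - X]Q1E mulrBl scalerAl.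
  have D10 : P1 - c *: Q1 != 0.
    by apply: contra_neq D0 => D10; rewrite DE D10 mul0r.
  have: (0 < mup a (P1 - c *: Q1))%N.
    rewrite -XsubC_dvd // dvdp_XsubCl /root !hornerE.
    by rewrite mulfVK // subrr.
  by rewrite /= DE mupM // mupZ -EQ; lia.
exists (lead_coef P / lead_coef Q); apply: has_value_ratio => //.
set D := P - _; have [->|D0] := eqVneq D 0; [by left | right].
have sPQ : size P = size Q by move: E; move: (size P) (size Q) => i k; lia.
have D1 : (size D <= (size P).-1)%N.
  apply/leq_sizeP => j; rewrite leq_eqVlt => /predU1P[<-|lt].
    rewrite /D !coefE [X in _ * Q`_X]/(_.-1) [in X in _ * Q`_X]sPQ.
    by rewrite divfK ?subrr // lead_coef_eq0.
  rewrite /D !coefE !nth_default ?mulr0 ?subr0 -?sPQ //; move: lt.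
  - by move: (size P) => i; lia.
  - by move: (size P) => i; lia.
move: P0 D1 sPQ; rewrite -size_poly_gt0 /=.
by move: (size P) (size D) (size Q) => i k l; lia.
Qed.

(** * Logarithmic forms and residues on the projective line *)

(** The coefficient of the form g dt with respect to the logarithmic generator
    ds/s, where s is the local parameter t - a, respectively 1/t. *)
Definition log_coef p g : ratfun R :=
  match p with Some a => (ratX - ratC a) * g | None => - (ratX * g) end.

Lemma log_coefE p g : log_coef p g = log_coef p 1 * g.
Proof. by case: p => [a|] /=; rewrite mulr1 ?mulNr. Qed.

Lemma log_coef1_neq0 p : log_coef p 1 != 0.
Proof.
case: p => [a|] /=; rewrite mulr1 ?oppr_eq0 ?tofrac_eq0 ?polyX_eq0 //.
by rewrite -tofracB tofrac_eq0 polyXsubC_eq0.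
Qed.

Lemma ord_log_coef p g : g != 0 -> ord p (log_coef p g) = form_ord p g + 1.
Proof.
move=> g0; rewrite log_coefE ordM ?log_coef1_neq0 // /form_ord.
case: p => [a|]; rewrite /log_coef mulr1.
  have -> : ratX - ratC a = ('X - a%:P)%:F by rewrite tofracB.
  rewrite ord_poly ?polyXsubC_eq0 //= -[X in mup a X]expr1.
  by rewrite mup_XsubCX eqxx addrC subr0.
rewrite -tofracN ord_poly ?oppr_eq0 ?polyX_eq0 //= size_polyN size_polyX.
by lia.
Qed.

Lemma form_log_poleE p g : form_log_pole p g <-> regular p (log_coef p g).
Proof.
have [->|g0] := eqVneq g 0.
  by split=> _; left; rewrite // log_coefE mulr0.
have l0 : log_coef p g != 0 by rewrite log_coefE mulf_neq0 ?log_coef1_neq0.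
split=> -[/eqP|h]; rewrite ?(negPf g0) ?(negPf l0) //; right.
  by move: h; rewrite (ord_log_coef p g0); move: (form_ord p g) => k; lia.
by move: h; rewrite (ord_log_coef p g0); move: (form_ord p g) => k; lia.
Qed.

Lemma form_regularE p g : form_regular p g <-> has_value p (log_coef p g) 0.
Proof.
rewrite has_valueE rmorph0 subr0.
have [->|g0] := eqVneq g 0.
  by split=> _; left; rewrite // log_coefE mulr0.
have l0 : log_coef p g != 0 by rewrite log_coefE mulf_neq0 ?log_coef1_neq0.
split=> -[/eqP|h]; rewrite ?(negPf g0) ?(negPf l0) //; right.
  by move: h; rewrite (ord_log_coef p g0); move: (form_ord p g) => k; lia.
by move: h; rewrite (ord_log_coef p g0); move: (form_ord p g) => k; lia.
Qed.

Lemma residue_eq p g c : has_value p (log_coef p g) c -> residue p g = c.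
Proof.
move=> h; rewrite /residue.
have -> : [set c | match p with
      | Some a => has_value p ((ratX - ratC a) * g) c
      | None => has_value p (- (ratX * g)) c end]%classic =
      [set c | has_value p (log_coef p g) c]%classic by case: (p).
by apply: (has_value_uniq _ h); apply: (@xgetI _ 0 [set c | _]%classic c h).
Qed.

Lemma residueP p g :
  form_log_pole p g -> has_value p (log_coef p g) (residue p g).
Proof.
move=> /form_log_poleE /regular_has_value[c h].
by rewrite (residue_eq h).
Qed.

Lemma log_coefB p g h : log_coef p (g - h) = log_coef p g - log_coef p h.
Proof. by rewrite log_coefE mulrBr -!log_coefE. Qed.

Lemma log_coefZ p x g : log_coef p (x * g) = x * log_coef p g.
Proof. by rewrite log_coefE mulrCA -log_coefE. Qed.

Lemma log_coef_sum p (I : finType) (A : pred I) (F : I -> ratfun R) :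
  log_coef p (\sum_(i | A i) F i) = \sum_(i | A i) log_coef p (F i).
Proof. by rewrite log_coefE mulr_sumr; apply: eq_bigr => i _; rewrite -log_coefE. Qed.

(** The polar part dt/(t - b) has a second pole, at infinity, with residue -1.
    With the zero form as polar part at infinity, a combination of polar parts
    whose coefficients add up to zero has the prescribed residues at infinity
    too. *)
Definition pole (q : P1 R) : ratfun R :=
  if q is Some b then (ratX - ratC b)^-1 else 0.

Lemma pole_value p q :
  has_value p (log_coef p (pole q)) ((q == p)%:R - (p == None)%:R).
Proof.
case: q => [b|] /=; last first.
  rewrite log_coefE mulr0 [None == p]eq_sym subrr.
  by left; rewrite rmorph0.
have XBE (c : C) : ratX - ratC c = ('X - c%:P)%:F by rewrite tofracB.
have X0 (c : C) : 'X - c%:P != 0 by rewrite polyXsubC_eq0.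
case: p => [a|] /=; last first.
  rewrite sub0r XBE -mulNr -tofracN; apply: has_value_ratio; first exact: X0.
  rewrite scaleN1r opprK addKr; have [->|b0] := eqVneq b 0.
    by left; rewrite oppr0.
  by right; rewrite /= size_XsubC size_polyN size_polyC b0.
rewrite subr0 !XBE; apply: has_value_ratio; first exact: X0.
rewrite (inj_eq Some_inj) eq_sym; have [->|ab] := eqVneq a b.
  by left; rewrite scale1r subrr.
right; rewrite scale0r subr0 /= -[X in mup a X]expr1 mup_XsubCX.
rewrite -[X in _ < Posz (mup a X)]expr1 mup_XsubCX eqxx.
by rewrite eq_sym (negPf ab).
Qed.

Lemma polar_parts_value p (I : finType) (A : {set I}) (q : I -> P1 R)
    (c : I -> C) :
  has_value p (log_coef p (\sum_(i in A) ratC (c i) * pole (q i)))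
    (\sum_(i in A | q i == p) c i - (\sum_(i in A) c i) *+ (p == None)).
Proof.
rewrite log_coef_sum.
have -> : \sum_(i in A | q i == p) c i - (\sum_(i in A) c i) *+ (p == None) =
    \sum_(i in A) c i * ((q i == p)%:R - (p == None)%:R).
  under [RHS]eq_bigr => i _ do rewrite mulrBr.
  rewrite big_split /= sumrN -mulr_suml mulr_natr; congr (_ - _).
  rewrite big_mkcondr /=; apply: eq_bigr => i _.
  by case: ifP; rewrite ?mulr1 ?mulr0.
apply: has_value_sum => i _; rewrite log_coefZ.
by apply: has_valueM; [apply: has_valueC | apply: pole_value].
Qed.

(** The sheaf of 1-forms on P^1 has degree -2, so allowing a simple pole at one
    point leaves it without global sections.  Concretely, g has no denominator
    left in lowest terms, and a polynomial does not vanish at infinity. *)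
Lemma regular_form_eq0 g : (forall a, form_regular (Some a) g) ->
  form_log_pole None g -> g = 0.
Proof.
move=> reg [//|]; have [//|g0] := eqVneq g 0.
have [P [Q [P0 Q0 gE]]] := ratfunP g0.
pose G := gcdp P Q; have G0 : G != 0 by rewrite gcdp_eq0 negb_and P0.
pose P1 := P %/ G; pose Q1 := Q %/ G.
have P1E : P = P1 * G by rewrite divpK // dvdp_gcdl.
have Q1E : Q = Q1 * G by rewrite divpK // dvdp_gcdr.
have cop : coprimep Q1 P1 by rewrite coprimep_sym coprimep_div_gcd ?P0.
have P10 : P1 != 0 by apply: contra_neq P0 => z; rewrite P1E z mul0r.
have Q10 : Q1 != 0 by apply: contra_neq Q0 => z; rewrite Q1E z mul0r.
have FG0 : G%:F != 0 by rewrite tofrac_eq0.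
have {}gE : g = P1%:F / Q1%:F.
  by rewrite gE [in LHS]P1E [in LHS]Q1E !tofracM invfM mulrACA (mulfV FG0) mulr1.
have sQ1 : size Q1 = 1%N.
  apply/eqP; apply/negPn/negP => /closed_rootP[a Qa].
  case: (reg a) => [/eqP|]; first by rewrite (negPf g0).
  rewrite /form_ord subr0 gE ord_ratio //=.
  rewrite mupNroot ?(coprimep_root cop) //.
  have: (0 < mup a Q1)%N by rewrite -XsubC_dvd // dvdp_XsubCl.
  by move: (mup a Q1) => k; lia.
rewrite /form_ord gE ord_ratio //= sQ1.
move: P10; rewrite -size_poly_gt0; move: (size P1) => k; lia.
Qed.

(** Subtracting the polar parts leaves a form whose only possible pole is a
    simple one at infinity, hence zero.  Its residue at infinity, which is the
    sum of all residues of g, is then zero as well. *)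
Lemma partial_fractions (I : finType) (A : {set I}) (q : I -> P1 R) g :
  {in A &, injective q} ->
  (forall i, i \in A -> form_log_pole (q i) g) ->
  (forall p, (forall i, i \in A -> p <> q i) -> form_regular p g) ->
  g = \sum_(i in A) ratC (residue (q i) g) * pole (q i) /\
  \sum_(i in A) residue (q i) g = 0.
Proof.
move=> qI lg reg; set c := fun i => residue (q i) g; set s := \sum_(i in A) c i.
set h := \sum_(i in A) _.
have hv p : has_value p (log_coef p g) (\sum_(i in A | q i == p) c i).
  have [/existsP[i /andP[iA /eqP <-]]|/existsPn nq] :=
      boolP [exists i, (i \in A) && (q i == p)].
    rewrite (bigD1 i) ?iA ?eqxx //= big1 ?addr0; first exact/residueP/lg.
    by move=> j /andP[/andP[jA /eqP /qI ->]] //; rewrite eqxx.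
  rewrite big_pred0 => [|i]; last by apply: negbTE; apply: nq.
  by apply/form_regularE/reg => i iA pq; have := nq i; rewrite iA pq eqxx.
have hp p : has_value p (log_coef p (g - h)) (s *+ (p == None)).
  rewrite log_coefB -[s *+ _](subKr (\sum_(i in A | q i == p) c i)).
  by apply: has_valueD; [|apply: has_valueN]; [|apply: polar_parts_value].
have gh : g - h = 0.
  apply: regular_form_eq0 => [a|]; first exact/form_regularE/(hp (Some a)).
  exact/form_log_poleE/(has_value_regular (hp None)).
split; first by apply/eqP; rewrite -subr_eq0 gh.
apply: (has_value_uniq (hp None)); rewrite gh log_coefE mulr0.
by left; rewrite rmorph0.
Qed.

(** In a local parameter s at p, x is s^k times a unit, k being the order, so
    dlog x is k ds/s up to a regular form.  On a polynomial P this says that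
    (t - a) P' - k P vanishes to higher order than P at a, and that t P' - k P
    has smaller degree than P if k is the degree of P. *)
Lemma dlog_value p x : x != 0 -> has_value p (log_coef p (dlog x)) (ord p x)%:~R.
Proof.
suff poly_value P : P != 0 ->
    has_value p (log_coef p (P^`()%:F / P%:F)) (poly_ord p P)%:~R.
  move=> x0; have d0 := rden_neq0 x.
  have n0 : rnum x != 0.
    by apply: contra_neq x0 => n0; rewrite [x]ratfunE n0 tofrac0 mul0r.
  rewrite [in ord _ _](ratfunE x) ord_ratio // rmorphB log_coefB.
  by apply: has_valueD; [|apply: has_valueN]; apply: poly_value.
move=> P0; case: p => [a|] /=.
  rewrite -tofracB mulrA -tofracM; apply: has_value_ratio => //.
  set k := mup a P; set D := _ - _; have [->|D0] := eqVneq D 0; [by left|right].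
  have /dvdpP[P1 P1E] : ('X - a%:P) ^+ k %| P by rewrite -mup_geq.
  rewrite /= ltz_nat -/k mup_geq //; apply/dvdpP; exists P1^`().
  rewrite /D P1E derivM deriv_exp derivXsubC mul1r -/k exprSr.
  case: (k) => [|j].
    by rewrite !expr0 scale0r mulr0n mulr0 addr0 subr0 !mulr1 mul1r mulrC.
  by rewrite scaler_int -pmulrn /= exprSr; ring.
rewrite mulrA -mulNr -tofracM -tofracN; apply: has_value_ratio => //.
set D := _ - _; have [->|D0] := eqVneq D 0; [by left|right].
have : (size D <= (size P).-1)%N.
  have XP' j : ('X * P^`())`_j = P`_j *+ j.
    by rewrite coefXM coef_deriv; case: j.
  have DE j : D`_j = ((size P).-1%:R - j%:R) * P`_j.
    rewrite /D coefB coefN coefZ XP'.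
    have -> : 1 - (size P)%:Z = - (size P).-1%:Z 
      by move: P0; rewrite -size_poly_gt0; case: (size P) => [|k] //= _; lia.
    by rewrite rmorphN /= -pmulrn -mulr_natl; ring.
  apply/leq_sizeP => j; rewrite DE leq_eqVlt => /predU1P[<-|lt].
    by rewrite subrr mul0r.
  rewrite nth_default ?mulr0 //; move: lt P0; rewrite -size_poly_gt0.
  by case: (size P).
move: P0; rewrite -size_poly_gt0 /=.
by move: (size P) (size D) => i j; lia.
Qed.

Lemma dlog_log_pole p x : x != 0 -> form_log_pole p (dlog x).
Proof. by move=> x0; apply/form_log_poleE/(has_value_regular (dlog_value p x0)). Qed.

Lemma residue_dlog p x : x != 0 -> residue p (dlog x) = (ord p x)%:~R.
Proof. by move=> x0; apply: residue_eq; apply: dlog_value. Qed.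

End RationalFunctions.

(** * Characters of a toric variety along a curve *)

Section Dot.
Variables (S : comPzRingType) (n : nat).
Implicit Types (x y : 'rV[S]_n) (a : S).

Lemma dotDl x y z : dot (x + y) z = dot x z + dot y z.
Proof. by rewrite -big_split /=; apply: eq_bigr => i _; rewrite mxE mulrDl. Qed.

Lemma dotZl a x z : dot (a *: x) z = a * dot x z.
Proof. by rewrite mulr_sumr; apply: eq_bigr => i _; rewrite mxE mulrA. Qed.

Lemma dotC x y : dot x y = dot y x.
Proof. by apply: eq_bigr => i _; rewrite mulrC. Qed.

Lemma dotDr x y z : dot z (x + y) = dot z x + dot z y.
Proof. by rewrite dotC dotDl !(dotC z). Qed.

Lemma dotZr a x z : dot z (a *: x) = a * dot z x.
Proof. by rewrite dotC dotZl dotC. Qed.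

Lemma dotNl x y : dot (- x) y = - dot x y.
Proof. by rewrite -scaleN1r dotZl mulN1r. Qed.

Lemma dotNr x y : dot x (- y) = - dot x y.
Proof. by rewrite dotC dotNl dotC. Qed.

Lemma dot0l y : dot (0 : 'rV_n) y = 0.
Proof. by apply: big1 => i _; rewrite mxE mul0r. Qed.

Lemma dot0r y : dot y (0 : 'rV_n) = 0.
Proof. by rewrite dotC dot0l. Qed.

Lemma dot_delta i y : dot (delta_mx 0 i) y = y 0 i.
Proof.
rewrite /dot (bigD1 i) //= mxE !eqxx mul1r big1 ?addr0 // => j ji.
by rewrite mxE (negPf ji) andbF mul0r.
Qed.

End Dot.

(** The gcd of the entries of u, up to sign, is a combination of them: each step
    adds one entry to the gcd. *)
Lemma dot_bezout n (u : 'rV[int]_n) (s : seq 'I_n) :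
  exists m : 'rV[int]_n, forall i, i \in s -> (dot m u %| u ord0 i)%Z.
Proof.
elim: s => [|j s [m IHs]]; first by exists 0.
have [a [b ab]] := Bezoutz (dot m u) (u 0 j).
exists (a *: m + b *: delta_mx 0 j) => i.
rewrite dotDl !dotZl dot_delta ab inE => /predU1P[->|/IHs]; first exact: dvdz_gcdr.
by apply: dvdz_trans; apply: dvdz_gcdl.
Qed.

(** A combination dividing all entries of a primitive vector is 1 or -1. *)
Lemma primitive_dual n (u : 'rV[int]_n) : primitive u -> exists m, dot m u = 1.
Proof.
move=> pu; have [m mu] := dot_bezout u (enum 'I_n); set g := dot m u in mu.
have g1 : `|g|%N = 1%N.
  apply: (pu _ (\row_i (sgz g * (u ord0 i %/ g)%Z))); apply/rowP => i.
  rewrite mulmxnE mxE -mulr_natr natz mulrAC -intEsg mulrC.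
  by rewrite divzK ?mu ?mem_enum.
exists (g *: m); rewrite dotZl -/g.
by case: (intP g) g1 => [|[|k]|[|k]] //.
Qed.

Section Characters.
Variables (R : realType) (n : nat).
Implicit Types (f : 'rV[int]_n -> ratfun R) (Sigma : set (set 'rV[R]_n)).

(** Away from the boundary the curve maps to the big torus, the orbit of the cone
    0, on which all characters are invertible. *)
Lemma ord_off_boundary Sigma f p : is_toric_map Sigma f ->
  ~ meets_boundary Sigma f p -> forall m, ord p (f m) = 0.
Proof.
move=> [_ /(_ p)[C SC fpC]] nb m.
have C0 : C = [set 0]%classic by apply: contrapT => C0; apply: nb; exists C.
have ann : annihilator C m by rewrite C0 => d ->; apply: dot0r.
have dC : dual_cone C m by move=> d /ann ->.
exact: ((fpC m dC).2).2 ann.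
Qed.

(** The intersection multiplicity gives the orders of the characters with
    <m,u> = 1, and by additivity of the order they determine all the others. *)
Lemma ord_meets_divisor Sigma f p u k : is_character_map f -> primitive u ->
  meets_divisor Sigma f p u k -> forall m, ord p (f m) = k%:Z * dot m u.
Proof.
move=> [f0 fM] pu [_ _ ordk] m; have [m0 m0u] := primitive_dual pu.
pose L m := ord p (f m).
have LD x y : L (x + y) = L x + L y by rewrite /L fM ordM.
have L0 : L 0 = 0 by have := LD 0 0; rewrite addr0; move: (L 0) => l; lia.
have LN x : L (- x) = - L x.
  by have := LD x (- x); rewrite subrr L0; move: (L x) (L (- x)) => l l'; lia.
have LMn x i : L (x *+ i) = i%:Z * L x.
  elim: i => [|i IHi]; first by rewrite mulr0n L0 mul0r.
  by rewrite mulrS LD IHi intS mulrDl mul1r.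
have LZ a x : L (a *: x) = a * L x.
  case: (intP a) => [|i|i]; first by rewrite scale0r L0 mul0r.
    by rewrite -[i.+1%:Z]natz scaler_nat LMn natz.
  by rewrite scaleNr LN -[i.+1%:Z]natz scaler_nat LMn natz mulNr.
have := ordk (m + (1 - dot m u) *: m0); rewrite -/(L _) LD LZ dotDl dotZl m0u.
have -> : L m0 = k%:Z by apply: ordk.
rewrite mulr1 addrCA subrr addr0 => /(_ erefl).
rewrite /L mulrBl mul1r mulrC.
move: (ord p (f m)) (k%:Z) (k%:Z * dot m u) => l a b; lia.
Qed.

End Characters.

(** * Residues of the sections of the dual obstruction space *)

(** As the diagonal vanishes, the sum of two opposite entries is the pairing of
    r i + r j with w i + w j.  By balancing these are, up to sign, the values at
    the third index if there is one, and zero otherwise. *)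
Lemma dot_antisymmetric (S : comPzRingType) n (I : finType) (A : {set I})
    (r w : I -> 'rV[S]_n) : (#|A| <= 3)%N ->
  \sum_(i in A) r i = 0 -> \sum_(i in A) w i = 0 ->
  (forall i, i \in A -> dot (r i) (w i) = 0) ->
  forall i j, i \in A -> j \in A -> dot (r i) (w j) + dot (r j) (w i) = 0.
Proof.
move=> A3 r0 w0 rw0 i j iA jA; have [<-|ij] := eqVneq i j.
  by rewrite rw0 // addr0.
have -> : dot (r i) (w j) + dot (r j) (w i) = dot (r i + r j) (w i + w j).
  by rewrite dotDl !dotDr !rw0 // add0r addr0.
pose B := A :\ i :\ j.
have jAi : j \in A :\ i by rewrite !inE eq_sym ij.
have split (F : I -> 'rV[S]_n) : \sum_(k in A) F k = F i + F j + \sum_(k in B) F k.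
  by rewrite (big_setD1 i) //= (big_setD1 j) //= addrA.
have pair (F : I -> 'rV[S]_n) : \sum_(k in A) F k = 0 ->
    F i + F j = - \sum_(k in B) F k.
  by rewrite split => /eqP; rewrite addr_eq0 => /eqP.
rewrite !pair //.
have : (#|B| <= 1)%N.
  by move: A3; rewrite (cardsD1 i) iA (cardsD1 j) jAi.
rewrite leq_eqVlt ltnS leqn0 => /orP[/cards1P[k Bk]|].
  rewrite Bk !big_set1 dotNl dotNr opprK rw0 //.
  by have : k \in B by [rewrite Bk inE]; rewrite !inE => /and3P[].
by rewrite cards_eq0 => /eqP ->; rewrite !big_set0 oppr0 dot0l.
Qed.

Section Component.
Variables (R : realType) (n : nat) (T : tropical_data R n).
Variables (K : set (set 'rV[R]_n)) (phi : curve_map T).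
Hypotheses (primT : forall e : edge T, primitive (dir e))
  (weightT : forall e : edge T, (0 < weight e)%N) (hphi : prelog_of_type K phi).
Local Notation C := R[i].
Implicit Types (v : vert T) (e : edge T) (b : bool) (f : edge T * bool).
Implicit Types (xi : {ffun vert T -> 'rV[ratfun R]_n}).

Lemma primitive_out_dir e b : primitive (out_dir e b).
Proof.
case: b; rewrite /out_dir /sgb /= ?expr1 ?expr0 ?scale1r ?scaleN1r => // k u' uE.
by apply: (primT (e := e) (u' := - u')); rewrite mulNrn -uE opprK.
Qed.

Lemma flag_pointP v f : f \in at_vertex v -> ends T f.1 f.2 = Some v.
Proof. by rewrite inE => /eqP. Qed.

Lemma flag_point_inj v : {in at_vertex v &, injective (fun f => fpt phi f.1 f.2)}.
Proof.
move=> [e b] [e' b'] /flag_pointP /= ev /flag_pointP /= ev'.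
exact: (pl_distinct hphi ev ev').
Qed.

Lemma char_neq0 v m : cmap phi v m != 0.
Proof. by have [[[]]] := pl_transverse hphi v. Qed.

Lemma ord_flag v e b m : ends T e b = Some v ->
  ord (fpt phi e b) (cmap phi v m) = (weight e)%:Z * dot m (out_dir e b).
Proof.
move=> ev; have [[[cm _] _] md] := (pl_transverse hphi v, pl_flag hphi ev).
exact: (ord_meets_divisor cm (@primitive_out_dir e b) md).
Qed.

Lemma ord_not_flag v p m :
  (forall e b, ends T e b = Some v -> p <> fpt phi e b) ->
  ord p (cmap phi v m) = 0.
Proof.
move=> np; have [tm _] := pl_transverse hphi v.
apply: (ord_off_boundary tm) => /(pl_exact hphi)[e [b [ev pE]]].
exact: np ev pE.
Qed.

(** The residue at a flag of the N-valued form that pairs with m to d log chi^m. *)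
Definition flow_dir e b : 'rV[C]_n := (weight e)%:R *: ext C (out_dir e b).

Lemma residue_dlog_char v e b i : ends T e b = Some v ->
  residue (fpt phi e b) (dlog (cmap phi v (delta_mx 0 i))) = flow_dir e b 0 i.
Proof.
move=> ev; rewrite residue_dlog ?char_neq0 // (ord_flag _ ev) dot_delta.
by rewrite /flow_dir !mxE rmorphM /= -pmulrn.
Qed.

Lemma dlog_char_fractions v i :
  dlog (cmap phi v (delta_mx 0 i)) =
    \sum_(f in at_vertex v) ratC (flow_dir f.1 f.2 0 i) * pole (fpt phi f.1 f.2) /\
  \sum_(f in at_vertex v) flow_dir f.1 f.2 0 i = 0.
Proof.
have reg p : (forall f, f \in at_vertex v -> p <> fpt phi f.1 f.2) ->
    form_regular p (dlog (cmap phi v (delta_mx 0 i))).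
  move=> np; apply/form_regularE.
  have := dlog_value p (char_neq0 v (delta_mx 0 i)).
  by rewrite ord_not_flag // => e b ev; apply: (np (e, b)); rewrite inE ev.
have [E E0] := partial_fractions (@flag_point_inj v)
  (fun f _ => dlog_log_pole _ (char_neq0 v _)) reg.
split.
  rewrite [LHS]E; apply: eq_bigr => f /flag_pointP fv.
  by rewrite (residue_dlog_char i fv).
rewrite -[RHS]E0; apply: eq_bigr => f /flag_pointP fv.
by rewrite (residue_dlog_char i fv).
Qed.

Lemma dot_log_tangent v (x : 'rV[ratfun R]_n) theta :
  dot x (log_tangent phi v theta) =
  theta * \sum_i x 0 i * dlog (cmap phi v (delta_mx 0 i)).
Proof. by rewrite mulr_sumr; apply: eq_bigr => i _; rewrite mxE mulrCA. Qed.

Lemma residue_atE xi v e b i : ends T e b = Some v ->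
  residue_at phi xi e b 0 i = residue (fpt phi e b) (xi v 0 i).
Proof. by rewrite /residue_at => ->; rewrite mxE. Qed.

Lemma flag_log_pole xi v e b i : omega_section phi xi ->
  ends T e b = Some v -> form_log_pole (fpt phi e b) (xi v 0 i).
Proof.
move=> [reg [lg _]] ev; have [be|nbe] := boolP (bounded e); first exact: lg.
apply/form_log_poleE/(@has_value_regular _ _ _ 0)/form_regularE/reg.
move=> e' b' be' ev' /(pl_distinct hphi ev ev')[ee' _].
by rewrite ee' be' in nbe.
Qed.

Lemma residue_unbounded xi e b : omega_section phi xi -> ~~ bounded e ->
  residue_at phi xi e b = 0.
Proof.
move=> [reg _] nbe; apply/rowP => i; rewrite mxE.
case ev : (ends T e b) => [v|]; last by rewrite /residue_at ev mxE.
rewrite (residue_atE _ _ ev); apply/residue_eq/form_regularE/reg.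
move=> e' b' be' ev' /(pl_distinct hphi ev ev')[ee' _].
by rewrite ee' be' in nbe.
Qed.

Lemma section_fractions xi v i : omega_section phi xi ->
  xi v 0 i = \sum_(f in at_vertex v)
    ratC (residue_at phi xi f.1 f.2 0 i) * pole (fpt phi f.1 f.2) /\
  \sum_(f in at_vertex v) residue_at phi xi f.1 f.2 0 i = 0.
Proof.
move=> oxi; have [reg _] := oxi.
have reg' p : (forall f, f \in at_vertex v -> p <> fpt phi f.1 f.2) ->
    form_regular p (xi v 0 i).
  move=> np; apply: reg => e b _ ev; apply: (np (e, b)).
  by rewrite inE ev.
have [E E0] := partial_fractions (@flag_point_inj v)
  (fun f fv => flag_log_pole i oxi (flag_pointP fv)) reg'.
split.
  rewrite [LHS]E; apply: eq_bigr => f /flag_pointP fv.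
  by rewrite (residue_atE _ _ fv).
rewrite -[RHS]E0; apply: eq_bigr => f /flag_pointP fv.
by rewrite (residue_atE _ _ fv).
Qed.

(** On a curve of valence at most 3 these are exactly the families of residues of
    the elements of the dual obstruction space; at the missing ends of unbounded
    edges the value is zero, so that the condition on edges also forces the
    residues at the marked points to vanish. *)
Record residue_flow (r : edge T -> bool -> 'rV[C]_n) : Prop := ResidueFlow {
  flow_end : forall e b, ends T e b = None -> r e b = 0;
  flow_edge : forall e, r e false + r e true = 0;
  flow_vertex : forall v, \sum_(f in at_vertex v) r f.1 f.2 = 0;
  flow_orth : forall e b, dot (r e b) (ext C (dir e)) = 0 }.

Lemma dot_flow_dir (x : 'rV[C]_n) e b :
  dot x (flow_dir e b) = (weight e)%:R * (-1) ^+ b * dot x (ext C (dir e)).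
Proof.
rewrite /flow_dir dotZr -mulrA; congr (_ * _).
rewrite -dotZr; congr (dot _ _).
by apply/rowP => i; rewrite !mxE rmorphM rmorphXn rmorphN1.
Qed.

(** The condition on directions comes from the quadratic differential obtained by
    contracting xi with d log: its coefficient at a double pole is the pairing of
    the two residues, up to the positive weight. *)
Lemma residue_at_flow xi : dual_obstruction phi xi -> residue_flow (residue_at phi xi).
Proof.
move=> [oxi vanish]; split.
- by move=> e b ev; rewrite /residue_at ev.
- move=> e; have [be|nbe] := boolP (bounded e); last first.
    by rewrite !residue_unbounded // addr0.
  have [_ [_ opp]] := oxi; move: be; rewrite /bounded.
  case ev: (ends T e false) => [v|//]; case ew: (ends T e true) => [w|//] _.
  by apply/rowP => i; rewrite !mxE (residue_atE _ _ ev) (residue_atE _ _ ew) opp.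
- move=> v; apply/rowP => i; rewrite summxE mxE.
  exact: (section_fractions v i oxi).2.
move=> e b; case ev: (ends T e b) => [v|]; last by rewrite /residue_at ev dot0l.
set p := fpt phi e b.
have : has_value p
    (\sum_(i < n) log_coef p (xi v 0 i) *
       log_coef p (dlog (cmap phi v (delta_mx 0 i))))
    (\sum_(i < n) residue_at phi xi e b 0 i * flow_dir e b 0 i).
  apply: has_value_sum => i _; apply: has_valueM.
    by rewrite (residue_atE _ _ ev); apply/residueP/(flag_log_pole _ oxi ev).
  by rewrite -(residue_dlog_char i ev); apply/residueP/dlog_log_pole/char_neq0.
have -> : \sum_(i < n) log_coef p (xi v 0 i) *
       log_coef p (dlog (cmap phi v (delta_mx 0 i))) = 0.
  (* log_coef p is multiplication by log_coef p 1, so this is the contraction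
     with a multiple of the vector field d/dt. *)
  have := vanish v (log_coef p 1 * log_coef p 1).
  rewrite dot_log_tangent mulr_sumr => E.
  rewrite -[RHS]E; apply: eq_bigr => i _.
  rewrite log_coefE [X in _ * X]log_coefE; ring.
rewrite -/(dot (residue_at phi xi e b) (flow_dir e b)) => h0.
have h : has_value p 0 (0 : C) by left; rewrite rmorph0.
have /eqP := has_value_uniq h0 h; rewrite dot_flow_dir !mulf_eq0.
rewrite signr_eq0 pnatr_eq0 (gtn_eqF (weightT e)) /= => /eqP //.
Qed.

Lemma residue_at_inj xi eta : dual_obstruction phi xi -> dual_obstruction phi eta ->
  residue_at phi xi =2 residue_at phi eta -> xi = eta.
Proof.
move=> [oxi _] [oeta _] E; apply/ffunP => v; apply/rowP => i.
rewrite (section_fractions v i oxi).1 (section_fractions v i oeta).1.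
by apply: eq_bigr => f _; rewrite E.
Qed.

Definition flow_section (r : edge T -> bool -> 'rV[C]_n) :
    {ffun vert T -> 'rV[ratfun R]_n} :=
  [ffun v => \row_i \sum_(f in at_vertex v)
     ratC (r f.1 f.2 0 i) * pole (fpt phi f.1 f.2)].

Lemma flow_section_value r v p i : residue_flow r ->
  has_value p (log_coef p (flow_section r v 0 i))
    (\sum_(f in at_vertex v | fpt phi f.1 f.2 == p) r f.1 f.2 0 i).
Proof.
move=> fr; rewrite ffunE mxE.
have := polar_parts_value p (at_vertex v) (fun f => fpt phi f.1 f.2)
  (fun f => r f.1 f.2 0 i).
have -> : \sum_(f in at_vertex v) r f.1 f.2 0 i = 0 by
  have := congr1 (fun x : 'rV_n => x 0 i) (flow_vertex fr v); rewrite summxE mxE.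
by rewrite mul0rn subr0.
Qed.

Lemma flow_section_flag r v e b i : residue_flow r -> ends T e b = Some v ->
  has_value (fpt phi e b) (log_coef (fpt phi e b) (flow_section r v 0 i)) (r e b 0 i).
Proof.
move=> fr ev; have := flow_section_value v (fpt phi e b) i fr.
rewrite (bigD1 (e, b)) ?inE ?ev ?eqxx //= big1 ?addr0 // => f.
case/andP=> /andP[fv /eqP fE] /negP[]; apply/eqP.
have eb : (e, b) \in at_vertex v by rewrite inE ev.
exact: (flag_point_inj fv eb fE).
Qed.

Lemma residue_flow_section r e b : residue_flow r ->
  residue_at phi (flow_section r) e b = r e b.
Proof.
move=> fr; case ev: (ends T e b) => [v|].
  by apply/rowP => i; rewrite (residue_atE _ _ ev); apply/residue_eq/flow_section_flag.
by rewrite /residue_at ev (flow_end fr ev).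
Qed.

Lemma flow_unbounded r e b : residue_flow r -> ~~ bounded e -> r e b = 0.
Proof.
move=> fr; rewrite /bounded negb_and => nbe.
have E := flow_edge fr e; case/orP: nbe.
  case ev: (ends T e false) => [//|] _; have r0 := flow_end fr ev.
  by case: b => //; move: E; rewrite r0 add0r.
case ev: (ends T e true) => [//|] _; have r0 := flow_end fr ev.
by case: b => //; move: E; rewrite r0 addr0.
Qed.

(** The quadratic differential of a residue flow is a double sum over the flags
    at a vertex, with antisymmetric coefficients and symmetric terms. *)
Lemma flow_section_obstruction r : (forall v, #|at_vertex v| <= 3)%N ->
  residue_flow r -> dual_obstruction phi (flow_section r).
Proof.
move=> v3 fr; split; [split; [|split]|].
- move=> v p i np; apply/form_regularE.
  have := flow_section_value v p i fr; rewrite big1 // => f /andP[fv /eqP fE].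
  rewrite flow_unbounded ?mxE //; apply/negP => bf.
  by apply: (np f.1 f.2 bf _ (esym fE)); apply: flag_pointP.
- move=> v e b i _ ev.
  exact/form_log_poleE/(has_value_regular (flow_section_flag i fr ev)).
- move=> e v w i ev ew; rewrite -(residue_atE _ _ ev) -(residue_atE _ _ ew).
  rewrite !residue_flow_section //.
  by have := congr1 (fun x : 'rV_n => x 0 i) (flow_edge fr e); rewrite !mxE.
move=> v theta; rewrite dot_log_tangent.
set Q := \sum_i _; suff -> : Q = 0 by rewrite mulr0.
pose q (f : edge T * bool) := pole (fpt phi f.1 f.2).
pose s (f g : edge T * bool) := dot (r f.1 f.2) (flow_dir g.1 g.2).
have QE : Q = \sum_(f in at_vertex v) \sum_(g in at_vertex v) ratC (s f g) * (q f * q g).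
  have -> : Q = \sum_i \sum_(f in at_vertex v) \sum_(g in at_vertex v)
      ratC (r f.1 f.2 0 i * flow_dir g.1 g.2 0 i) * (q f * q g).
    apply: eq_bigr => i _; rewrite ffunE mxE (dlog_char_fractions v i).1.
    rewrite mulr_suml; apply: eq_bigr => f _; rewrite mulr_sumr.
    by apply: eq_bigr => g _; rewrite rmorphM mulrACA.
  rewrite exchange_big; apply: eq_bigr => f _; rewrite exchange_big.
  by apply: eq_bigr => g _; rewrite -mulr_suml rmorph_sum.
have s0 f g : f \in at_vertex v -> g \in at_vertex v -> s f g + s g f = 0.
  apply: (dot_antisymmetric (r := fun f => r f.1 f.2)
    (w := fun g => flow_dir g.1 g.2)) => //.
  - exact: flow_vertex.
  - by apply/rowP => i; rewrite summxE mxE (dlog_char_fractions v i).2.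
  by move=> h _; rewrite dot_flow_dir (flow_orth fr) mulr0.
have : Q + Q = 0.
  rewrite {2}QE exchange_big QE -big_split big1 //= => f fv.
  rewrite -big_split big1 //= => g gv.
  by rewrite [q g * _]mulrC -mulrDl -rmorphD s0 // rmorph0 mul0r.
have two : ratC (2%:R : C) != 0 by rewrite ratC_eq0 pnatr_eq0.
move=> QQ; apply: (mulfI two).
by rewrite rmorph_nat mulr0 mulr_natl mulr2n.
Qed.

End Component.

(** * Cycles and the loop part of a graph *)

Section Cycles.
Variables (G : graph) (F : numFieldType).
Implicit Types (e : edge G) (v : vert G) (c : edge G -> F).

(** If removing [e] keeps the first Betti number, then the cycles that avoid [e]
    already fill the space of all rational cycles.  The cycles over [F] are
    spanned by the rational ones, since a kernel commutes with an extension of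
    the field. *)
Lemma cycle_off_loop_part e c :
  (forall e', ~~ bounded e' -> c e' = 0) ->
  (forall v, \sum_e' c e' * ((ends G e' true == Some v)%:R
                             - (ends G e' false == Some v)%:R) = 0) ->
  e \notin loop_part G -> c e = 0.
Proof.
move=> cu cv; rewrite inE -leqNgt => rk.
have [be|/cu//] := boolP (bounded e).
pose A := [set e' in [set: edge G] | bounded e'].
pose B := [set e' in [set: edge G] :\ e | bounded e'].
pose MA := boundary [set: edge G]; pose MB := boundary ([set: edge G] :\ e).
(* The inclusion of the chains that avoid e. *)
pose J : 'M[rat]_(#|B|, #|A|) := \matrix_(i, j) (enum_val i == enum_val j)%:R.
have eA : e \in A by rewrite !inE be.
have BA (i : 'I_#|B|) : enum_val i \in A.
  by have := enum_valP i; rewrite !inE => /andP[_ ->].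
have JE (i : 'I_#|B|) j : J i j = (j == enum_rank_in eA (enum_val i))%:R.
  rewrite mxE; congr ((_ : bool)%:R); apply/eqP/eqP => [->|->].
    by rewrite enum_valK_in.
  by rewrite enum_rankK_in.
have JM : J *m MA = MB.
  apply/matrixP => i k; rewrite mxE (bigD1 (enum_rank_in eA (enum_val i))) //=.
  rewrite big1 => [|j ji]; last by rewrite JE (negPf ji) mul0r.
  by rewrite JE eqxx mul1r addr0 !mxE enum_rankK_in.
have JJ : row_free J.
  apply/row_freeP; exists J^T; apply/matrixP => i k.
  rewrite mxE (bigD1 (enum_rank_in eA (enum_val i))) //= big1 => [|j ji].
    rewrite JE eqxx mul1r addr0 !mxE enum_rankK_in //.
    by rewrite (inj_eq enum_val_inj) eq_sym.
  by rewrite JE (negPf ji) mul0r.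
have kerBA : (kermx MB *m J <= kermx MA)%MS.
  by apply/sub_kermxP; rewrite -mulmxA JM mulmx_ker.
have kerAB : (kermx MA <= kermx MB *m J)%MS.
  by rewrite -(geq_leqif (mxrank_leqif_sup kerBA)) mxrankMfree.
pose x : 'rV[F]_#|A| := \row_i c (enum_val i).
have xMA : x *m map_mx ratr MA = 0.
  apply/rowP => k; rewrite !mxE -[RHS](cv (enum_val k)).
  rewrite [RHS](bigID (mem A)) /= [X in _ = _ + X]big1 ?addr0; last first.
    by move=> e' e'A; rewrite cu ?mul0r //; move: e'A; rewrite !inE.
  rewrite [RHS]big_enum_val; apply: eq_bigr => i _.
  by rewrite !mxE rmorphB /= !ratr_nat.
have : (x <= map_mx ratr (kermx MB *m J))%MS.
  apply: submx_trans (_ : x <= map_mx ratr (kermx MA))%MS _.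
    by rewrite map_kermx; apply/sub_kermxP.
  by rewrite map_submx.
case/submxP => y /(congr1 (fun z : 'rV_#|A| => z 0 (enum_rank_in eA e))).
rewrite mxE enum_rankK_in // map_mxM mulmxA mxE => ->.
apply: big1 => i _; rewrite [X in _ * X]mxE JE.
case: eqP => [/(congr1 (@enum_val _ (mem A)))|_]; last by rewrite rmorph0 mulr0.
rewrite !enum_rankK_in // => eE.
by have := enum_valP i; rewrite -eE !inE eqxx.
Qed.

End Cycles.

(** * Flows of residues on a trivalent curve *)

Section Flows.
Variables (R : realType) (n : nat) (T : tropical_data R n).
Local Notation C := R[i].
Variable r : edge T -> bool -> 'rV[C]_n.
Hypothesis fr : residue_flow r.
Implicit Types (e : edge T) (v : vert T) (b : bool).

Lemma flow_falseE e : r e false = - r e true.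
Proof. by apply/eqP; rewrite -addr_eq0 (flow_edge fr). Qed.

Lemma sum_flags (V : nmodType) v (h : edge T -> bool -> V) :
  \sum_(f in at_vertex v) h f.1 f.2 =
  \sum_e \sum_b (if ends T e b == Some v then h e b else 0).
Proof. by rewrite big_mkcond pair_bigA; apply: eq_bigr => f _; rewrite inE. Qed.

(** Each coordinate of a residue flow, with the values at the ends [true] as
    coefficients, is a cycle. *)
Lemma flow_off_loop_part e b : e \notin loop_part T -> r e b = 0.
Proof.
move=> eL; suff rt : r e true = 0 by case: b; rewrite ?flow_falseE ?rt ?oppr0.
apply/rowP => i; rewrite mxE.
apply: (@cycle_off_loop_part _ _ e (fun e => r e true 0 i)) eL => [e' nb|v].
  by rewrite (flow_unbounded _ fr nb) mxE.
have := congr1 (fun x : 'rV_n => x 0 i) (flow_vertex fr v); rewrite summxE mxE.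
rewrite (sum_flags v (fun e b => r e b 0 i)) => E; rewrite -[RHS]E.
apply: eq_bigr => e' _; rewrite big_bool /= flow_falseE mxE mulrBr.
by congr (_ + _); case: ifP; rewrite ?mulr1 ?mulr0 ?oppr0.
Qed.

(** Two edges that are not cut apart meet at a trivalent vertex whose third edge
    lies off the loop part and carries the value zero, so their values are equal
    up to sign. *)
Lemma uncut_adjacent_orth e e' x : trivalent T -> uncut_adjacent e e' ->
  dot (r e true) x = 0 -> dot (r e' true) x = 0.
Proof.
move=> h3 /and3P[eL e'L /existsP[v /and3P[lv /existsP[b /eqP ev] /existsP[b' /eqP ev']]]].
have [<-//|ee'] := eqVneq e e' => rx.
have fb e0 b0 : (dot (r e0 b0) x == 0) = (dot (r e0 true) x == 0).
  by case: b0 => //; rewrite flow_falseE dotNl oppr_eq0.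
apply/eqP; rewrite -(fb _ b').
have f1 : (e, b) \in at_vertex v by rewrite inE ev.
have f2 : (e', b') \in at_vertex v :\ (e, b).
  by rewrite !inE ev' eqxx andbT; apply: contraNneq ee' => -[->].
have [h hv hL] : exists2 h, h \in at_vertex v & h.1 \notin loop_part T.
  apply/exists_inP; apply: contraNT lv; rewrite negb_exists_in => /forall_inP hL.
  rewrite -(h3 v) /loop_valence; apply/eqP; congr #|pred_of_set _|.
  by apply/setP => f; rewrite inE; case: (boolP (f \in _)) => //= /hL; rewrite negbK.
have h3' : h \in at_vertex v :\ (e, b) :\ (e', b').
  rewrite !in_setD1 hv andbT; apply/andP; split.
    by apply: contraNneq hL => ->.
  by apply: contraNneq hL => ->.
have rest : at_vertex v :\ (e, b) :\ (e', b') = [set h].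
  apply/esym/eqP; rewrite eqEcard finset.sub1set h3' cards1 /=.
  by have := h3 v; rewrite (cardsD1 (e, b)) f1 (cardsD1 (e', b')) f2 !add1n => -[->].
have := flow_vertex fr v.
rewrite (big_setD1 (e, b)) //= (big_setD1 (e', b')) //= rest big_set1.
rewrite (flow_off_loop_part _ hL) addr0 => /eqP; rewrite addrC addr_eq0 => /eqP ->.
by rewrite dotNl oppr_eq0 fb rx.
Qed.

End Flows.

(** * Data on the flags as flows *)

Section FlagData.
Variables (R : realType) (n : nat) (T : tropical_data R n).
Local Notation C := R[i].
Implicit Types (D : {ffun flag T -> 'rV[C]_n}) (e : edge T) (v : vert T) (b : bool).

Lemma uncut_adjacent_sym : symmetric (@uncut_adjacent T).
Proof.
suff imp e e' : uncut_adjacent e e' -> uncut_adjacent e' e.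
  by move=> e e'; apply/idP/idP; apply: imp.
move=> /and3P[eL e'L /existsP[v /and3P[lv ev ev']]].
by apply/and3P; split=> //; apply/existsP; exists v; rewrite lv ev ev'.
Qed.

Lemma connect_uncut_orth (r : edge T -> bool -> 'rV[C]_n) e e' x :
  trivalent T -> residue_flow r -> connect (@uncut_adjacent T) e e' ->
  dot (r e true) x = 0 -> dot (r e' true) x = 0.
Proof.
move=> h3 fr /connectP[s + ->]; elim: s e => [//|e1 s IHs] e /= /andP[ee1 p] re.
exact/(IHs e1)/(uncut_adjacent_orth fr h3 ee1).
Qed.

(** Unbounded edges do not enter the boundary map. *)
Lemma unbounded_off_loop_part e : ~~ bounded e -> e \notin loop_part T.
Proof.
move=> nbe; rewrite inE -leqNgt /betti1 /boundary.
suff -> : [set e' in [set: edge T] :\ e | bounded e'] =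
  [set e' in [set: edge T] | bounded e'] by [].
by apply/setP => e'; rewrite !inE andbT; case: eqVneq => [->|] //=; apply/esym/negbTE.
Qed.

(** Flags are pairs (edge, end) whose end exists; zero at the missing ends is
    the convention of [residue_flow]. *)
Definition data_flow D e b : 'rV[C]_n :=
  if insub (e, b) is Some f then D f else 0.

Lemma data_flowE D (f : flag T) : data_flow D (val f).1 (val f).2 = D f.
Proof. by rewrite /data_flow -surjective_pairing valK. Qed.

Lemma data_flowT D e b (eb : ends T (e, b).1 (e, b).2) :
  data_flow D e b = D (exist _ (e, b) eb).
Proof. by rewrite -data_flowE. Qed.

Lemma data_flow_none D e b : ends T e b = None -> data_flow D e b = 0.
Proof. by move=> ev; rewrite /data_flow insubN //= ev. Qed.

Lemma sum_flag_data D v : \sum_(f in at_vertex v) data_flow D f.1 f.2 =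
  \sum_(f : flag T | val f \in at_vertex v) D f.
Proof.
rewrite (reindex_omap (val : flag T -> edge T * bool) insub) /= => [|f].
  by apply: eq_big => [f|f _]; rewrite ?valK ?eqxx ?andbT ?data_flowE.
by rewrite inE => /eqP fv; rewrite insubT ?fv.
Qed.

Lemma own_segment e : e \in loop_part T ->
  exists2 l, l \in segments T & e \in l.
Proof.
move=> eL; exists [set e' | connect (@uncut_adjacent T) e e'].
  by apply/imsetP; exists e.
by rewrite inE connect0.
Qed.

Lemma loop_data_flow D : loop_data D -> residue_flow (data_flow D).
Proof.
move=> [dI dII da db].
have d0 e b : e \notin loop_part T -> data_flow D e b = 0.
  move=> eL; case ev: (ends T e b) => [v|]; last exact: data_flow_none.
  have fP : ends T (e, b).1 (e, b).2 by rewrite ev.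
  by rewrite (data_flowT D fP) dI.
split.
- exact: data_flow_none.
- move=> e; have [eL|eL] := boolP (e \in loop_part T); last by rewrite !d0 // addr0.
  have be : bounded e by apply: contraLR eL; apply: unbounded_off_loop_part.
  have [f0 f1] := andP be; have [l lS el] := own_segment eL.
  pose f : flag T := exist _ (e, false) f0; pose f' : flag T := exist _ (e, true) f1.
  have ff' : f != f' by apply/eqP => /(congr1 (fun g : flag T => (val g).2)).
  have := db l lS f f' el erefl ff'.
  by rewrite (data_flowT D f0) (data_flowT D f1).
- by move=> v; rewrite sum_flag_data da.
move=> e b; have [eL|eL] := boolP (e \in loop_part T); last by rewrite d0 // dot0l.
have be : bounded e by apply: contraLR eL; apply: unbounded_off_loop_part.
have [l lS el] := own_segment eL.
have fP : ends T (e, b).1 (e, b).2 by case/andP: be; case: (b).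
rewrite (data_flowT D fP).
apply: (dII l lS) => //; rewrite /segment_span (bigD1 e) //=.
by apply: (subvP (addvSl _ _)); apply: memv_line.
Qed.

Lemma flow_loop_data D : trivalent T -> residue_flow (data_flow D) -> loop_data D.
Proof.
move=> h3 fr; split.
- by move=> f fL; rewrite -data_flowE (flow_off_loop_part fr).
- move=> l /imsetP[e0 e0L ->] f; rewrite inE => e0f u /memv_sumP[w wS ->].
  rewrite dotC /dot; under eq_bigr => i _ do rewrite summxE mulr_suml.
  rewrite exchange_big big1 //= => e e0e; rewrite -/(dot (w e) (D f)).
  have /vlineP[a ->] := wS e e0e; rewrite dotZl dotC.
  suff -> : dot (D f) (ext C (dir e)) = 0 by rewrite mulr0.
  rewrite inE in e0e.
  have ef : connect (@uncut_adjacent T) e (flag_edge f).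
    by apply: connect_trans e0f; rewrite (sym_connect_sym uncut_adjacent_sym).
  have := connect_uncut_orth h3 fr ef (flow_orth fr e true).
  rewrite -data_flowE /flag_edge; case: (val f).2 => // h.
  by rewrite (flow_falseE fr) dotNl h oppr0.
- by move=> v; rewrite -sum_flag_data (flow_vertex fr).
move=> l lS f f' fl ff' nff'; rewrite -!data_flowE.
have E := flow_edge fr (flag_edge f).
have E1 : (val f').1 = (val f).1 by [].
have E2 : (val f').2 = ~~ (val f).2.
  have : (val f').2 != (val f).2.
    apply: contra_neq nff' => E2; apply: val_inj.
    by rewrite [val f]surjective_pairing [val f']surjective_pairing E1 E2.
  by case: (val f).2; case: (val f').2.
by rewrite E1 E2; move: E; rewrite /flag_edge; case: (val f).2; rewrite // addrC.
Qed.

End FlagData.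

(** * Subdivided curves *)

Section Subdivided.
Variables (R : realType) (n : nat) (T : tropical_data R n) (S : subdivision T).
Local Notation C := R[i].
Local Notation T' := (subdivide S).
Implicit Types (e : edge T) (b : bool).

Definition piece e (i : 'I_(nsub S e).+1) : edge T' :=
  Tagged (fun e => 'I_(nsub S e).+1) i.

Definition new_vert e (j : 'I_(nsub S e)) : vert T' :=
  inr (Tagged (fun e => 'I_(nsub S e)) j).

Lemma ends_end_piece e b : ends T' (end_piece S e b) b = omap inl (ends T e b).
Proof. by rewrite /= /sub_ends /=; case: b; rewrite unlift_none. Qed.

Lemma ends_new e (j : 'I_(nsub S e)) b :
  ends T' (piece (lift (if b then ord_max else ord0) j)) b = Some (new_vert j).
Proof. by rewrite /= /sub_ends /= liftK. Qed.

(** An end of a piece of [e] is either an end of [e] itself or an added vertex. *)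
Lemma subdivide_flag_ind (P : edge T' -> bool -> Prop) :
  (forall e b, P (end_piece S e b) b) ->
  (forall e (j : 'I_(nsub S e)) b,
     P (piece (lift (if b then ord_max else ord0) j)) b) ->
  forall x b, P x b.
Proof.
move=> Pend Pnew [e i] b.
case: (unliftP (if b then ord_max else ord0) i) => [j|] ->; first exact: Pnew.
exact: Pend.
Qed.

Lemma at_old_vertex (v : vert T) :
  at_vertex (inl v : vert T') = [set (end_piece S f.1 f.2, f.2) | f in at_vertex v].
Proof.
apply/setP => -[x b]; apply/idP/imsetP => [|[f fv ->]]; last first.
  by rewrite inE ends_end_piece (flag_pointP fv).
move=> /flag_pointP; move: x b; apply: subdivide_flag_ind => [e b|e j b].
  rewrite ends_end_piece => ev; exists (e, b) => //; rewrite inE.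
  by case: (ends T e b) ev => [w|] //= [->].
by rewrite ends_new.
Qed.

Lemma at_new_vertex e (j : 'I_(nsub S e)) :
  at_vertex (new_vert j) =
    [set (piece (lift ord_max j), true); (piece (lift ord0 j), false)].
Proof.
apply/setP => -[x b]; apply/idP/set2P => [|[] ->]; last first.
- by rewrite inE (ends_new j false).
- by rewrite inE (ends_new j true).
move=> /flag_pointP; move: x b; apply: subdivide_flag_ind => [e' b|e' k b].
  by rewrite ends_end_piece; case: (ends T e' b).
rewrite ends_new => -[ee']; move: k; rewrite ee' => k E.
have -> : k = j := eq_from_Tagged E.
by case: b; [left | right].
Qed.

Lemma card_at_vertex (v : vert T') : trivalent T -> (#|at_vertex v| <= 3)%N.
Proof.
move=> h3; case: v => [v|[e j]].
  by rewrite at_old_vertex -(h3 v) leq_imset_card.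
by rewrite (at_new_vertex j) cards2; case: (_ != _).
Qed.

(** The residues are opposite on the two sides of an added vertex and at the two
    ends of a piece, so passing to the next piece changes the sign twice. *)
Lemma flow_pieces r e (i : 'I_(nsub S e).+1) b : @residue_flow R n T' r ->
  r (piece i) b = r (end_piece S e b) b.
Proof.
move=> fr.
have step (j : 'I_(nsub S e)) :
    r (piece (lift ord0 j)) false = r (piece (lift ord_max j)) false.
  have := flow_vertex fr (new_vert j); rewrite at_new_vertex big_setU1 /= ?big_set1.
    rewrite (flow_falseE fr (piece (lift ord_max j))) => /eqP.
    by rewrite addrC addr_eq0 => /eqP.
  by rewrite inE -pair_eqE /= andbF.
have const (k : 'I_(nsub S e).+1) : r (piece k) false = r (end_piece S e false) false.
  case: k => k; elim: k => [|k IHk] lk.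
    by rewrite (_ : Ordinal lk = ord0) //; apply: val_inj.
  have lk' : (k < nsub S e)%N by [].
  have -> : Ordinal lk = lift ord0 (Ordinal lk') by apply: val_inj.
  rewrite step -(IHk (ltnW lk)) (_ : lift ord_max _ = Ordinal (ltnW lk)) //.
  by apply: val_inj; rewrite /= /bump leqNgt lk'.
case: b; last exact: const.
apply: oppr_inj; rewrite -!(flow_falseE fr) const.
exact/esym/const.
Qed.

Lemma subdivide_flow (r : edge T -> bool -> 'rV[C]_n) :
  @residue_flow R n T' (fun x b => r (tag x) b) <-> residue_flow r.
Proof.
have old (v : vert T) : \sum_(f in at_vertex (inl v : vert T')) r (tag f.1) f.2 =
    \sum_(f in at_vertex v) r f.1 f.2.
  rewrite at_old_vertex big_imset //= => -[e b] [e' b'] _ _ /= [] ee' _ bb'.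
  by rewrite ee' bb'.
split=> fr; split.
- move=> e b ev; apply: (flow_end fr (e := end_piece S e b)).
  by rewrite ends_end_piece ev.
- by move=> e; apply: (flow_edge fr (end_piece S e true)).
- by move=> v; rewrite -old (flow_vertex fr).
- by move=> e b; apply: (flow_orth fr (end_piece S e b)).
- apply: subdivide_flag_ind => [e b|e j b]; last by rewrite ends_new.
  by rewrite ends_end_piece; case ev: (ends T e b) => //= _; apply: flow_end ev.
- by case=> e i; apply: (flow_edge fr).
- case=> [v|[e j]]; first by rewrite old (flow_vertex fr).
  rewrite (at_new_vertex j) big_setU1 /= ?big_set1 /=; last first.
    by rewrite inE -pair_eqE /= andbF.
  by rewrite addrC (flow_edge fr).
by case=> e i b; apply: (flow_orth fr).
Qed.

End Subdivided.

(** * Description of the dual obstruction space *)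

Section Linearity.
Variables (R : realType) (n : nat) (T : tropical_data R n).
Implicit Types r s : edge T -> bool -> 'rV[R[i]]_n.

Lemma residue_flow_linear (c : R[i]) r s : residue_flow r -> residue_flow s ->
  residue_flow (fun e b => c *: r e b + s e b).
Proof.
move=> fr fs; split=> [e b ev|e|v|e b].
- by rewrite (flow_end fr ev) (flow_end fs ev) scaler0 addr0.
- by rewrite addrACA -scalerDr (flow_edge fr) (flow_edge fs) scaler0 addr0.
- by rewrite big_split /= -scaler_sumr (flow_vertex fr) (flow_vertex fs) scaler0 addr0.
by rewrite dotDl dotZl (flow_orth fr) (flow_orth fs) mulr0 addr0.
Qed.

Lemma flow_section_linear (phi : curve_map T) c r s :
  flow_section phi (fun e b => c *: r e b + s e b) =
  [ffun v => ratC c *: flow_section phi r v + flow_section phi s v].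
Proof.
apply/ffunP => v; apply/rowP => i; rewrite !(ffunE, mxE) mulr_sumr -big_split.
by apply: eq_bigr => f _; rewrite !mxE rmorphD rmorphM mulrDl mulrA.
Qed.

End Linearity.

Lemma data_flow_residues (R : realType) (n : nat) (T : tropical_data R n)
    (S : subdivision T) (phi : curve_map (subdivide S))
    (xi : {ffun vert (subdivide S) -> 'rV[ratfun R]_n}) e b :
  data_flow (flag_residues phi xi) e b = residue_at phi xi (end_piece S e b) b.
Proof.
case ev: (ends T e b) => [v|].
  have eb : ends T (e, b).1 (e, b).2 by rewrite ev.
  by rewrite (data_flowT _ eb) ffunE.
by rewrite data_flow_none // /residue_at ends_end_piece ev.
Qed.

Theorem theorem44 (R : realType) (n : nat)
    (T : tropical_data R n) (hT : immersive_tropical_curve T)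
    (h3 : trivalent T)
    (S : subdivision T) (Sigma K : set (set 'rV[R]_n)) (d : nat)
    (hdeg : respects S Sigma K d)
    (phi : curve_map (subdivide S)) (hphi : prelog_of_type K phi) :
  (forall (c : R[i]) xi eta,
     dual_obstruction phi xi -> dual_obstruction phi eta ->
     dual_obstruction phi [ffun v => ratC c *: xi v + eta v] /\
     flag_residues phi [ffun v => ratC c *: xi v + eta v] =
       [ffun f => c *: flag_residues phi xi f + flag_residues phi eta f]) /\
  set_bij (dual_obstruction phi) (@loop_data R n T) (flag_residues phi).
Proof.
have primT := tc_primitive (deg_subdivision hdeg).
have weightT := tc_weight (deg_subdivision hdeg).
have card3 v : (#|at_vertex v| <= 3)%N := card_at_vertex (S := S) v h3.
have toflow xi : dual_obstruction phi xi -> residue_flow (residue_at phi xi).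
  exact: (residue_at_flow primT weightT hphi).
have sectionE xi : dual_obstruction phi xi ->
    xi = flow_section phi (residue_at phi xi).
  move=> Hxi; have fr := toflow xi Hxi.
  apply: (residue_at_inj hphi Hxi) => [|e b].
    exact: (flow_section_obstruction primT hphi).
  by rewrite (residue_flow_section hphi).
have dataE xi x b : dual_obstruction phi xi ->
    residue_at phi xi x b = data_flow (flag_residues phi xi) (tag x) b.
  move=> Hxi; rewrite data_flow_residues; case: x => e i.
  exact: (flow_pieces _ _ (toflow xi Hxi)).
split=> [c xi eta Hxi Heta|].
  have fl := residue_flow_linear c (toflow xi Hxi) (toflow eta Heta).
  have -> : [ffun v => ratC c *: xi v + eta v] = flow_section phi
      (fun e b => c *: residue_at phi xi e b + residue_at phi eta e b).
    by rewrite flow_section_linear -!sectionE.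
  split; first exact: (flow_section_obstruction primT hphi).
  by apply/ffunP => f; rewrite !ffunE (residue_flow_section hphi).
split.
- move=> xi Hxi; apply: flow_loop_data => //; apply/(subdivide_flow S).
  rewrite (_ : (fun x b => _) = residue_at phi xi); first exact: toflow.
  by apply/funext => x; apply/funext => b; rewrite dataE.
- move=> xi eta /set_mem Hxi /set_mem Heta E.
  by apply: (residue_at_inj hphi Hxi Heta) => x b; rewrite !dataE // E.
move=> D LD; have fr := (subdivide_flow S _).2 (loop_data_flow LD).
exists (flow_section phi (fun x b => data_flow D (tag x) b)).
  exact: (flow_section_obstruction primT hphi).
apply/ffunP => f; rewrite ffunE (residue_flow_section hphi) //.
exact: data_flowE.
Qed.
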